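(* For every pair of positive numbers $a<b$ there exist a real entire function $f$ of exponential type $b$, whose restriction to the real line is bounded and belongs to $L^1(\mathbf{R})$ and which has a spectral gap $(-a,a)$, and a sequence of intervals $[y_k,x_k]\subset\mathbf{R}$ whose lengths $x_k-y_k$ tend to infinity, such that $f$ has no zeros on $[y_k,x_k]$ for every $k$.
   Context: A real entire function is one taking real values on $\mathbf{R}$. ''Of exponential type $b$'' means that for every $\epsilon>0$ there is $C_\epsilon$ with $|f(z)|\le C_\epsilon e^{(b+\epsilon)|z|}$ for all $z\in\mathbf{C}$ (type at most $b$). Spectral gap: for a locally integrable $f$ with $\int|f(x)|e^{-\lambda|x|}dx<\infty$ for all $\lambda>0$, put $F^+(z)=\int_{-\infty}^0 f(t)e^{-itz}dt$ for $\operatorname{Im}z>0$ and $F^-(z)=-\int_0^\infty f(t)e^{-itz}dt$ for $\operatorname{Im}z<0$; $f$ has a spectral gap $(-a,a)$ if $F^+$ and $F^-$ are analytic continuations of each other through $(-a,a)$. (For $f\in L^1(\mathbf{R})$ this means that the usual Fourier transform $\hat f(t)=\int f(x)e^{-itx}dx$ vanishes on $(-a,a)$.) *)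

(* Defs.v *)
From mathcomp Require Import all_boot all_order all_algebra.
From mathcomp Require Import all_classical all_reals all_analysis.
From mathcomp Require Import complex.

Set Implicit Arguments.
Unset Strict Implicit.
Unset Printing Implicit Defensive.

Import Order.TTheory GRing.Theory Num.Theory.
Import numFieldNormedType.Exports.

Local Open Scope classical_set_scope.
Local Open Scope ring_scope.
Local Open Scope complex_scope.

(* The R-valued modulus; the norm `|z| of R[i] takes values in R[i]. *)
Definition cabs (R : realType) (z : R[i]) : R := ComplexField.Normc.normc z.

Definition cexp (R : realType) (z : R[i]) : R[i] :=
  (expR (complex.Re z) * cos (complex.Im z))
    +i* (expR (complex.Re z) * sin (complex.Im z)).

(* R[i] carries the topology and the normed-module structure over itself only
   through its regular alias R[i]^o, so the derivative below is the limit of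
   (f (z + h) - f z) / h over complex h, i.e. complex differentiability. *)
Definition analytic_on (R : realType) (D : set R[i]) (f : R[i] -> R[i]) : Prop :=
  forall z, D z -> derivable (f : R[i]^o -> R[i]^o) z 1.

Definition entire (R : realType) (f : R[i] -> R[i]) : Prop :=
  analytic_on setT f.

Definition real_entire (R : realType) (f : R[i] -> R[i]) : Prop :=
  entire f /\ forall x : R, complex.Im (f x%:C) = 0.

(* Type at most b. *)
Definition exponential_type (R : realType) (b : R) (f : R[i] -> R[i]) : Prop :=
  forall e : R, 0 < e ->
    exists C : R, forall z : R[i], cabs (f z) <= C * expR ((b + e) * cabs z).

(* Integrability and integrals of complex-valued functions on the line, with
   respect to Lebesgue measure, through real and imaginary parts. *)
Definition cintegrable (R : realType) (D : set R) (f : R -> R[i]) : Prop :=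
  (@lebesgue_measure R).-integrable D (fun x => (complex.Re (f x))%:E) /\
  (@lebesgue_measure R).-integrable D (fun x => (complex.Im (f x))%:E).

Definition clocally_integrable (R : realType) (f : R -> R[i]) : Prop :=
  locally_integrable setT (fun x => complex.Re (f x)) /\
  locally_integrable setT (fun x => complex.Im (f x)).

Definition cintegral (R : realType) (D : set R) (f : R -> R[i]) : R[i] :=
  Rintegral (@lebesgue_measure R) D (fun x => complex.Re (f x))
    +i* Rintegral (@lebesgue_measure R) D (fun x => complex.Im (f x)).

Definition Fplus (R : realType) (f : R -> R[i]) (z : R[i]) : R[i] :=
  cintegral `]-oo, 0] (fun t => f t * cexp ((- t)*i * z)).

Definition Fminus (R : realType) (f : R -> R[i]) (z : R[i]) : R[i] :=
  - cintegral `[0, +oo[ (fun t => f t * cexp ((- t)*i * z)).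

Definition subexponential (R : realType) (f : R -> R[i]) : Prop :=
  clocally_integrable f /\
  forall l : R, 0 < l ->
    (\int[@lebesgue_measure R]_x (cabs (f x) * expR (- l * `|x|))%:E < +oo)%E.

(* Fplus and Fminus are analytic continuations of each other through (-a, a):
   they are the restrictions to the open upper and lower half-planes of one
   function analytic on the union of these half-planes with (-a, a). *)
Definition spectral_gap (R : realType) (a : R) (f : R -> R[i]) : Prop :=
  subexponential f /\
  exists G : R[i] -> R[i],
    [/\ analytic_on
          [set z : R[i] |
            complex.Im z != 0 \/ (- a < complex.Re z) && (complex.Re z < a)] G,
        forall z : R[i], 0 < complex.Im z -> G z = Fplus f z &
        forall z : R[i], complex.Im z < 0 -> G z = Fminus f z].

(* Main.v *)
Require Import Defs.
From mathcomp Require Import all_boot all_order all_algebra.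
From mathcomp Require Import all_classical all_reals all_analysis.
From mathcomp Require Import measurable_realfun complex ring lra.

Set Implicit Arguments.
Unset Strict Implicit.
Unset Printing Implicit Defensive.

Import Order.TTheory GRing.Theory Num.Theory.
Import numFieldNormedType.Exports.

Local Open Scope classical_set_scope.
Local Open Scope ring_scope.
Local Open Scope complex_scope.

(** For a continuous density [phi] on [[a, b]] put
    E(z) = \int_a^b phi(x) e^{ixz} dx and f(z) = E(z) + conj (E (conj z)).
    Then f is real entire of exponential type b, and if E is integrable on the
    line then the Cauchy transform of the density continues F^+ to F^-
    through (-a, a); it remains to choose phi so that Re E is positive on long
    intervals.

    With B = - al / s, the n-th power
    e^{i al t} (1 + B (e^{ist/n} - 1))^n has frequencies in [[al, al + s]] but
    tends to 1 uniformly on compact sets (superoscillation).  Multiplying it by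
    the transform of a narrow bump gives, for each L, a density whose transform
    is O(1 / (1 + t^2)) and has real part at least 1 on [[-L, L]].  The sum
    \sum_k eps_k E_k(t - c_k) of such transforms does the rest: eps_k is so
    small that the terms after k do not disturb the k-th one, and then c_k is so
    far away that the terms before k have decayed. *)

(** Frequencies of modulus at least [a] suggest a sign change on every interval of length comparable
    with 1/a; positivity on [-L, L] has to be bought with cancellation. As [B] is negative, 1 + B
    (e^{iy} - 1) combines only the frequencies 0 and 1, yet near y = 0 it turns like e^{iBy}, at a
    rate outside [0, 1]. At y = st/n its n-th power imitates e^{-i al t} and undoes the carrier e^{i
    al t}. The price is coefficients of alternating sign with absolute sum (1 - 2B)^n, where n grows
    with L, so the constants of the blocks get out of hand and the weights eps_k must be built from
    them. The decay 1 / (1 + t^2) serves twice: it makes the shifted terms summable in L^1 wherever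
    they sit, and it lets distance alone silence the earlier terms. Translating a transform by c
    multiplies its density by e^{-ixc}, of modulus 1; hence the densities converge uniformly for any
    shifts, and their sum is one continuous density on [a, b], to which the arguments on type and
    gap apply once. *)

Local Notation Re := complex.Re.
Local Notation Im := complex.Im.

(** * Complex numbers and the complex exponential *)

Section ComplexBasics.
Variable R : realType.
Implicit Types (z w : R[i]) (x t : R).

Lemma cReD z w : Re (z + w) = Re z + Re w. Proof. by case: z; case: w. Qed.
Lemma cImD z w : Im (z + w) = Im z + Im w. Proof. by case: z; case: w. Qed.
Lemma cReN z : Re (- z) = - Re z. Proof. by case: z. Qed.
Lemma cImN z : Im (- z) = - Im z. Proof. by case: z. Qed.
Lemma cReM z w : Re (z * w) = Re z * Re w - Im z * Im w.
Proof. by case: z; case: w. Qed.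
Lemma cImM z w : Im (z * w) = Re z * Im w + Im z * Re w.
Proof. by case: z => a b; case: w => c d. Qed.

Definition ReImE := (cReD, cImD, cReN, cImN, cReM, cImM).

Lemma complex_eq z w : Re z = Re w -> Im z = Im w -> z = w.
Proof. by case: z => a b; case: w => c d /= -> ->. Qed.

Lemma cabsM z w : cabs (z * w) = cabs z * cabs w.
Proof. exact: ComplexField.Normc.normcM. Qed.

Lemma cabsV z : cabs z^-1 = (cabs z)^-1.
Proof. exact: ComplexField.Normc.normcV. Qed.

Lemma ler_cabsD z w : cabs (z + w) <= cabs z + cabs w.
Proof. exact: le_normcD. Qed.

Lemma cabsN z : cabs (- z) = cabs z.
Proof. exact: normcN. Qed.

Lemma ler_cabsB z w : cabs (z - w) <= cabs z + cabs w.
Proof. by rewrite -(cabsN w) ler_cabsD. Qed.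

Lemma cabs0 : cabs (0 : R[i]) = 0.
Proof. exact: ComplexField.Normc.normc0. Qed.

Lemma cabs1 : cabs (1 : R[i]) = 1.
Proof. exact: ComplexField.Normc.normc1. Qed.

Lemma cabs_ge0 z : 0 <= cabs z.
Proof. by case: z => a b; exact: sqrtr_ge0. Qed.

Lemma cabs_eq0 z : cabs z = 0 -> z = 0.
Proof. exact: ComplexField.Normc.eq0_normc. Qed.

Lemma cabs_sqr z : cabs z ^+ 2 = Re z ^+ 2 + Im z ^+ 2.
Proof. by case: z => a b; rewrite /cabs /= sqr_sqrtr // addr_ge0 ?sqr_ge0. Qed.

Lemma ler_Re_cabs z : `|Re z| <= cabs z.
Proof.
by rewrite -(@ler_pXn2r _ 2) ?nnegrE ?cabs_ge0// cabs_sqr real_normK ?num_real// lerDl sqr_ge0.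
Qed.

Lemma ler_Im_cabs z : `|Im z| <= cabs z.
Proof.
by rewrite -(@ler_pXn2r _ 2) ?nnegrE ?cabs_ge0// cabs_sqr real_normK ?num_real// lerDr sqr_ge0.
Qed.

Lemma Re_le_cabs z : Re z <= cabs z.
Proof. exact: le_trans (ler_norm _) (ler_Re_cabs _). Qed.

Lemma ler_cabs_ReIm z : cabs z <= `|Re z| + `|Im z|.
Proof.
rewrite -(@ler_pXn2r _ 2) ?nnegrE ?cabs_ge0 ?addr_ge0// cabs_sqr.
rewrite sqrrD !real_normK ?num_real// addrAC lerDl.
by rewrite mulrn_wge0// mulr_ge0.
Qed.

Lemma cabsR x : cabs x%:C = `|x|.
Proof. by rewrite /cabs /= expr0n /= addr0 sqrtr_sqr. Qed.

Lemma cabsi : cabs ('i : R[i]) = 1.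
Proof. by rewrite /cabs /= expr0n expr1n /= add0r sqrtr1. Qed.

Lemma cabsX z n : cabs (z ^+ n) = cabs z ^+ n.
Proof. by elim: n => [|n IH]; rewrite ?expr0 ?cabs1// !exprS cabsM IH. Qed.

Lemma cabs_conj z : cabs (conjc z) = cabs z.
Proof. by case: z => a b; rewrite /cabs /= sqrrN. Qed.

Lemma ler_cabs_sum (I : Type) (r : seq I) (P : pred I) (F : I -> R[i]) :
  cabs (\sum_(i <- r | P i) F i) <= \sum_(i <- r | P i) cabs (F i).
Proof.
elim/big_rec2 : _ => [|i y1 y2 _ le12]; first by rewrite cabs0.
by rewrite (le_trans (ler_cabsD _ _))// lerD2l.
Qed.

Lemma normCE z : `|z| = (cabs z)%:C. Proof. by []. Qed.

Lemma cexpD z w : cexp (z + w) = cexp z * cexp w.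
Proof.
apply: complex_eq; rewrite !ReImE /= !ReImE expRD ?cosD ?sinD; ring.
Qed.

Lemma cexp0 : cexp (0 : R[i]) = 1.
Proof. by rewrite /cexp /= expR0 cos0 sin0 mulr1 mulr0. Qed.

Lemma cabs_cexp z : cabs (cexp z) = expR (Re z).
Proof.
rewrite /cabs /cexp /= !exprMn -mulrDr cos2Dsin2 mulr1 sqrtr_sqr.
by rewrite ger0_norm // expR_ge0.
Qed.

Lemma cexp_nat z n : cexp (z *+ n) = cexp z ^+ n.
Proof. by elim: n => [|n IH]; rewrite ?mulr0n ?cexp0 ?expr0// mulrS cexpD IH exprS. Qed.

Lemma ler_norm_sin t : `|sin t| <= `|t|.
Proof.
wlog t0 : t / 0 < t.
  move=> H; have [t0|t0|->] := ltgtP t 0; last by rewrite sin0.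
  - by rewrite -normrN -sinN -(normrN t) H// oppr_gt0.
  - exact: H.
have [|c _] := @MVT R sin cos 0 t t0 (fun x _ => is_derive_sin x).
  by apply: continuous_subspaceT => x; exact: continuous_sin.
rewrite sin0 !subr0 => ->; rewrite normrM ler_piMl//.
by rewrite ler_norml cos_geN1 cos_le1.
Qed.

Lemma cos_sub1 t : `|cos t - 1| <= t ^+ 2 / 2.
Proof.
have -> : cos t - 1 = - (sin (t / 2) ^+ 2 *+ 2).
  have {1}-> : t = (t / 2) *+ 2 by rewrite mulr2n; lra.
  by rewrite cos_mulr2n cos2sin2; ring.
rewrite normrN normrMn normrX.
have : `|sin (t / 2)| ^+ 2 <= `|t / 2| ^+ 2 by rewrite lerXn2r ?nnegrE// ler_norm_sin.
rewrite (real_normK (num_real (t / 2))); nra.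
Qed.

(** The mean value theorem gives t^3 / 2, which stays below t^2 only up to 2; from there on the
    trivial bound 2 t takes over. *)
Lemma sin_sub t : `|sin t - t| <= t ^+ 2.
Proof.
wlog t0 : t / 0 < t.
  move=> H; have [t0|t0|->] := ltgtP t 0; last by rewrite sin0 subr0 normr0 expr0n.
  - by have := H (- t); rewrite oppr_gt0 t0 sinN -opprD normrN sqrrN; exact.
  - exact: H.
have [t2|t2] := leP 2 t.
  have := ler_norm_sin t; rewrite (gtr0_norm t0) => st.
  apply: (le_trans (ler_normB _ _)); rewrite (gtr0_norm t0); nra.
pose g (x : R) : R := sin x - x.
have dg (x : R) : is_derive x 1 g (cos x - 1).
  by apply: is_deriveB.
have [|c] := @MVT R g (fun x => cos x - 1) 0 t t0 (fun x _ => dg x).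
  by apply: continuous_subspaceT => x; apply: cvgB; [exact: continuous_sin|exact: cvg_id].
rewrite in_itv/= => /andP[c0 ct].
rewrite /g sin0 !subr0 => ->; rewrite normrM (gtr0_norm t0).
have := cos_sub1 c; nra.
Qed.

Lemma expR_sub1 t : `|t| <= 2^-1 -> `|expR t - 1 - t| <= 2 * t ^+ 2.
Proof.
rewrite ler_norml => /andP[t1 t2].
have h1 := expR_ge1Dx t; have h2 := expR_ge1Dx (- t).
have e0 := expR_gt0 t; have : expR t * expR (- t) = 1 by rewrite -expRD subrr expR0.
move=> e1; rewrite ger0_norm; last by lra.
have : expR t * (1 - t) <= expR t * expR (- t) by rewrite ler_pM2l.
rewrite e1 => h; have t3 : 0 < 1 - t by lra.
rewrite -(ler_pM2r t3); have : 0 <= t ^+ 2 * (1 - 2 * t) by rewrite mulr_ge0 ?sqr_ge0//; lra.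
lra.
Qed.

Lemma cexp_taylor1 z : cabs z <= 2^-1 ->
  cabs (cexp z - 1 - z) <= 3 * cabs z ^+ 2.
Proof.
move=> z2; have x2 := le_trans (ler_Re_cabs z) z2.
rewrite (cabs_sqr z); apply: (le_trans (ler_cabs_ReIm _)).
case: z {z2} x2 => x y /= x2; rewrite !oppr0 addr0.
have := expR_sub1 x2; have := cos_sub1 y; have := sin_sub y.
have := ler_norm_sin y.
have e0 := expR_gt0 x.
(* Both parts are split into summands that are each of second order in (x, y). *)
have -> : expR x * cos y - 1 - x = (expR x - 1 - x) + expR x * (cos y - 1) by ring.
have -> : expR x * sin y - y = (expR x - 1 - x) * sin y + x * sin y + (sin y - y) by ring.
move=> s1 s2 c2 ex.
have e2 : expR x <= 2 by move: ex x2; rewrite !ler_norml => /andP[_ ?] /andP[? ?]; nra.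
apply: (le_trans (lerD (ler_normD _ _) (le_trans (ler_normD _ _) (lerD (ler_normD _ _) (lexx _))))).
rewrite !normrM (gtr0_norm e0).
have nx := normr_ge0 x; have ny := normr_ge0 y.
have nxx : `|x| ^+ 2 = x ^+ 2 by rewrite real_normK ?num_real.
have nyy : `|y| ^+ 2 = y ^+ 2 by rewrite real_normK ?num_real.
have h1 : expR x * `|cos y - 1| <= 2 * (y ^+ 2 / 2) by apply: ler_pM => //; exact: ltW.
have h2 : `|expR x - 1 - x| * `|sin y| <= 2 * x ^+ 2 * `|y| by apply: ler_pM.
have h3 : `|x| * `|sin y| <= `|x| * `|y| by apply: ler_pM.
have h4 : 2 * x ^+ 2 * `|y| <= `|x| * `|y| by rewrite -nxx expr2 !mulrA ler_wpM2r//; nra.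
have := sqr_ge0 (`|x| - `|y|); rewrite sqrrB nxx nyy; lra.
Qed.

Lemma cexp_imagE t : cexp ('i * t%:C) = cos t +i* sin t.
Proof. by rewrite /cexp /= !(mul0r, mul1r, oppr0, add0r, expR0). Qed.

(** Unlike [cexp_taylor1] this has no restriction on the radius, because the quadratic bounds for
    sine and cosine hold on the whole line. *)
Lemma cexp_imag_taylor1 t :
  cabs (cexp ('i * t%:C) - 1 - 'i * t%:C) <= 2 * t ^+ 2.
Proof.
rewrite cexp_imagE; apply: (le_trans (ler_cabs_ReIm _)).
rewrite !ReImE /= !(mul0r, mul1r, mulr0, oppr0, addr0, add0r, subr0).
by have := cos_sub1 t; have := sin_sub t; have := sqr_ge0 t; lra.
Qed.

Lemma cexp_imag_sub1 t : cabs (cexp ('i * t%:C) - 1) <= 2 * `|t|.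
Proof.
have -> : cexp ('i * t%:C) - 1 = (2 * sin (t / 2))%:C * ('i * cexp ('i * (t / 2)%:C)).
  have {1}-> : t = (t / 2) *+ 2 by rewrite mulr2n; lra.
  rewrite !cexp_imagE cos_mulr2n sin_mulr2n cos2sin2.
  by apply: complex_eq; rewrite !ReImE /=; ring.
rewrite !cabsM cabsi cabs_cexp cabsR normrM !ReImE /= !(mulr0, mul0r, subrr, expR0, mulr1).
rewrite normr_nat; have := ler_norm_sin (t / 2).
rewrite normrM normfV normr_nat; have := normr_ge0 t; lra.
Qed.

Lemma cabs_cexp_imag t : cabs (cexp ('i * t%:C)) = 1.
Proof. by rewrite cabs_cexp !ReImE /= !(mulr0, mul0r, subrr, expR0). Qed.

End ComplexBasics.

(** * Differentiation *)

Section QuadraticDerivative.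
Variable R : realType.
Implicit Types (z w c : R[i]) (x t : R) (f g : R[i] -> R[i]).

(* The quadratic remainder gives, in one predicate, complex differentiability
   and the derivatives of the real and imaginary parts along the line; it is
   also stable under integration in a parameter. *)
Definition qder f z D := exists M r, [/\ 0 <= M, 0 < r &
  forall h, cabs h <= r -> cabs (f (z + h) - f z - D * h) <= M * cabs h ^+ 2].

Lemma qder_cst c z : qder (fun=> c) z 0.
Proof. by exists 0, 1; split => // h _; rewrite subrr mul0r subrr cabs0 mul0r. Qed.

Lemma qder_id z : qder id z 1.
Proof.
exists 0, 1; split => // h _.
by rewrite mul1r -addrA -opprD subrr cabs0 mul0r.
Qed.

Lemma qderD f g z D E : qder f z D -> qder g z E ->
  qder (fun w => f w + g w) z (D + E).
Proof.
move=> [M [r [M0 r0 H]]] [N [s [N0 s0 K]]].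
exists (M + N), (Num.min r s); split; [exact: addr_ge0|by rewrite lt_min r0|].
move=> h; rewrite le_min => /andP[/H {}H /K {}K].
have -> : f (z + h) + g (z + h) - (f z + g z) - (D + E) * h =
  (f (z + h) - f z - D * h) + (g (z + h) - g z - E * h) by ring.
by rewrite mulrDl (le_trans (ler_cabsD _ _))// lerD.
Qed.

Lemma qderM f g z D E : qder f z D -> qder g z E ->
  qder (fun w => f w * g w) z (D * g z + f z * E).
Proof.
move=> [M [r [M0 r0 H]]] [N [s [N0 s0 K]]].
pose A := cabs (g z) + cabs E + N; pose B := cabs (f z) + cabs D.
exists (M * A + B * N + cabs D * cabs E), (Num.min 1 (Num.min r s)); split.
- by rewrite !addr_ge0 ?mulr_ge0// ?addr_ge0 ?cabs_ge0.
- by rewrite !lt_min ltr01 r0.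
move=> h; rewrite !le_min => /and3P[h1 /H {}H /K {}K].
have -> : f (z + h) * g (z + h) - f z * g z - (D * g z + f z * E) * h =
  (f (z + h) - f z - D * h) * g (z + h)
  + (f z + D * h) * (g (z + h) - g z - E * h) + (D * h) * (E * h) by ring.
have h0 := cabs_ge0 h.
have hh : cabs h ^+ 2 <= 1 by rewrite expr_le1.
have gA : cabs (g (z + h)) <= A.
  have -> : g (z + h) = g z + E * h + (g (z + h) - g z - E * h) by ring.
  apply: (le_trans (ler_cabsD _ _)); apply: lerD; last first.
    by apply: (le_trans K); rewrite ler_piMr.
  apply: (le_trans (ler_cabsD _ _)); rewrite lerD2l cabsM.
  by rewrite ler_piMr ?cabs_ge0.
have fB : cabs (f z + D * h) <= B.
  apply: (le_trans (ler_cabsD _ _)); rewrite lerD2l cabsM.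
  by rewrite ler_piMr ?cabs_ge0.
apply: (le_trans (ler_cabsD _ _)); rewrite [leRHS]mulrDl; apply: lerD; last first.
  by rewrite !cabsM mulrACA -expr2.
apply: (le_trans (ler_cabsD _ _)); rewrite [leRHS]mulrDl !cabsM; apply: lerD.
  by rewrite mulrAC; apply: ler_pM => //; exact: cabs_ge0.
by rewrite -mulrA; apply: ler_pM => //; exact: cabs_ge0.
Qed.

Lemma qderZ c f z D : qder f z D -> qder (fun w => c * f w) z (c * D).
Proof. by move=> fD; have := qderM (qder_cst c z) fD; rewrite mul0r add0r. Qed.

Lemma qder_cexp c z : qder (fun w => cexp (c * w)) z (c * cexp (c * z)).
Proof.
have c0 := cabs_ge0 c.
exists (cabs (cexp (c * z)) * 3 * cabs c ^+ 2), (2 * (cabs c + 1))^-1; split.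
- by rewrite !mulr_ge0 ?cabs_ge0 ?exprn_ge0.
- by rewrite invr_gt0; lra.
move=> h hr; have h0 := cabs_ge0 h.
have -> : cexp (c * (z + h)) - cexp (c * z) - c * cexp (c * z) * h =
  cexp (c * z) * (cexp (c * h) - 1 - c * h) by rewrite mulrDr cexpD; ring.
have K : cabs (cexp (c * h) - 1 - c * h) <= 3 * cabs (c * h) ^+ 2.
  apply: cexp_taylor1; rewrite cabsM.
  move: hr; rewrite -div1r ler_pdivlMr; last by lra.
  nra.
rewrite cabsM; apply: (le_trans (ler_wpM2l (cabs_ge0 _) K)).
by rewrite cabsM exprMn !mulrA.
Qed.

Lemma qder_derivable f z D : qder f z D -> derivable (f : R[i]^o -> R[i]^o) z 1.
Proof.
move=> [M [r [M0 r0 H]]]; apply/cvg_ex; exists (D : R[i]^o).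
apply/cvgrPdist_lt => e e0.
(* The order of [R[i]] compares only numbers with equal imaginary parts, so a positive [e] is
   real. *)
have [d d0 ed] : exists2 d : R, 0 < d & e = d%:C.
  move: e0; case: e => x y; rewrite ltcE /= => /andP[/eqP -> x0].
  by exists x.
have m0 : 0 < (Num.min r (d / (M + 1)))%:C.
  by rewrite ltcR lt_min r0 divr_gt0//; lra.
near=> h.
have h0 : h != 0 by near: h; exact: nbhs_dnbhs_neq.
have : `|h| < (Num.min r (d / (M + 1)))%:C.
  by near: h; exact: (@dnbhs0_lt _ R[i]^o).
rewrite normCE ltcR lt_min => /andP[hr hd].
have h0' : 0 < cabs h.
  by rewrite lt_neqAle cabs_ge0 andbT eq_sym; apply/negP => /eqP/cabs_eq0; apply/eqP.
rewrite normCE ed ltcR.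
have -> : D - h^-1 *: (f (h *: 1 + z) - f z) = - (h^-1 * (f (z + h) - f z - D * h)).
  rewrite /GRing.scale /= mulr1 (addrC h z); field.
  exact: h0.
rewrite cabsN cabsM cabsV.
rewrite mulrC ltr_pdivrMr//; apply: (le_lt_trans (H _ (ltW hr))).
rewrite expr2 mulrA ltr_pM2r//.
move: hd; rewrite ltr_pdivlMr; last by lra.
nra.
Unshelve. all: by end_near. Qed.

Lemma quad_is_derive (g : R -> R) (t d M r : R) : 0 <= M -> 0 < r ->
  (forall h, `|h| <= r -> `|g (t + h) - g t - d * h| <= M * `|h| ^+ 2) ->
  is_derive t 1 g d.
Proof.
move=> M0 r0 H; suff K : h^-1 *: (g (h *: 1 + t) - g t) @[h --> 0^'] --> d.
  by apply: DeriveDef; [apply/cvg_ex; exists d|exact: cvg_lim K].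
apply/cvgrPdist_lt => e e0.
have m0 : 0 < Num.min r (e / (M + 1)).
  by rewrite lt_min r0 divr_gt0//; lra.
near=> h.
have h0 : h != 0 by near: h; exact: nbhs_dnbhs_neq.
have : `|h| < Num.min r (e / (M + 1)) by near: h; exact: (@dnbhs0_lt _ R^o).
rewrite lt_min => /andP[hr hd].
have h0' : 0 < `|h| by rewrite normr_gt0.
have -> : d - h^-1 *: (g (h *: 1 + t) - g t) = - (h^-1 * (g (t + h) - g t - d * h)).
  rewrite /GRing.scale /= mulr1 (addrC h t); field.
  exact: h0.
rewrite normrN normrM normfV.
rewrite mulrC ltr_pdivrMr//; apply: (le_lt_trans (H _ (ltW hr))).
rewrite expr2 mulrA ltr_pM2r//.
move: hd; rewrite ltr_pdivlMr; last by lra.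
nra.
Unshelve. all: by end_near. Qed.

Lemma qder_Re f t D : qder f t%:C D -> is_derive t 1 (fun s : R => Re (f s%:C)) (Re D).
Proof.
move=> [M [r [M0 r0 H]]]; apply: (quad_is_derive M0 r0) => h.
rewrite -(cabsR h) => /H; rewrite -rmorphD; apply: le_trans.
apply: le_trans (ler_Re_cabs _).
by rewrite !ReImE /= mulr0 subr0.
Qed.

Lemma qder_Im f t D : qder f t%:C D -> is_derive t 1 (fun s : R => Im (f s%:C)) (Im D).
Proof.
move=> [M [r [M0 r0 H]]]; apply: (quad_is_derive M0 r0) => h.
rewrite -(cabsR h) => /H; rewrite -rmorphD; apply: le_trans.
apply: le_trans (ler_Im_cabs _).
by rewrite !ReImE /= mulr0 add0r.
Qed.

Lemma qder_conj f z D : qder f (conjc z) D -> qder (fun w => conjc (f (conjc w))) z (conjc D).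
Proof.
move=> [M [r [M0 r0 H]]]; exists M, r; split => // h.
rewrite -cabs_conj => /H.
rewrite -(cabs_conj (_ - _)) !(rmorphB, rmorphD, rmorphM) /=.
by rewrite conjcK cabs_conj.
Qed.

Lemma qder_opp f z D : qder f (- z) D -> qder (fun w => f (- w)) z (- D).
Proof.
move=> [M [r [M0 r0 H]]]; exists M, r; split => // h.
by rewrite -cabsN => /H; rewrite -opprD mulrN mulNr.
Qed.

Lemma eq_qder f g z D : f =1 g -> qder f z D -> qder g z D.
Proof. by move=> /funext ->. Qed.

End QuadraticDerivative.

(** * Integrals of complex-valued functions *)

Section ComplexIntegral.
Variable R : realType.
Implicit Types (z w c : R[i]) (x t u v : R) (F G : R -> R[i]) (A : set R).
Notation mu := (@lebesgue_measure R).

(** Componentwise, like [cintegrable] and [cintegral], so that results on real functions apply to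
    each part. *)
Definition ccontinuous F :=
  continuous (fun x => Re (F x)) /\ continuous (fun x => Im (F x)).

Lemma ccontinuous_cst c : ccontinuous (fun=> c).
Proof. by split; exact: cst_continuous. Qed.

Lemma ccontinuousD F G : ccontinuous F -> ccontinuous G ->
  ccontinuous (fun x => F x + G x).
Proof.
move=> [f1 f2] [g1 g2]; split.
  rewrite (_ : (fun _ => _) = (fun x => Re (F x) + Re (G x))); last first.
    by apply/funext => x; rewrite cReD.
  by move=> x; apply: cvgD; [exact: f1|exact: g1].
rewrite (_ : (fun _ => _) = (fun x => Im (F x) + Im (G x))); last first.
  by apply/funext => x; rewrite cImD.
by move=> x; apply: cvgD; [exact: f2|exact: g2].
Qed.

Lemma ccontinuousM F G : ccontinuous F -> ccontinuous G ->
  ccontinuous (fun x => F x * G x).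
Proof.
move=> [f1 f2] [g1 g2]; split.
  rewrite (_ : (fun _ => _) = (fun x => Re (F x) * Re (G x) - Im (F x) * Im (G x))); last first.
    by apply/funext => x; rewrite cReM.
  by move=> x; apply: cvgB; apply: cvgM; [exact: f1|exact: g1|exact: f2|exact: g2].
rewrite (_ : (fun _ => _) = (fun x => Re (F x) * Im (G x) + Im (F x) * Re (G x))); last first.
  by apply/funext => x; rewrite cImM.
by move=> x; apply: cvgD; apply: cvgM; [exact: f1|exact: g2|exact: f2|exact: g1].
Qed.

Lemma ccontinuousB F G : ccontinuous F -> ccontinuous G ->
  ccontinuous (fun x => F x - G x).
Proof.
move=> cF cG; have := ccontinuousD cF (ccontinuousM (ccontinuous_cst (-1)) cG).
by congr ccontinuous; apply/funext => x; rewrite mulN1r.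
Qed.

Lemma ccontinuous_real (g : R -> R) : continuous g -> ccontinuous (fun x => (g x)%:C).
Proof. by move=> cg; split => //=; exact: cst_continuous. Qed.

Lemma ccontinuous_sum n (F : nat -> R -> R[i]) : (forall k, ccontinuous (F k)) ->
  ccontinuous (fun x => \sum_(k < n) F k x).
Proof.
move=> cF; elim: n => [|n IH].
  by under eq_fun do rewrite big_ord0; exact: ccontinuous_cst.
by under eq_fun do rewrite big_ord_recr /=; exact: ccontinuousD.
Qed.

Lemma ccontinuousV F : (forall x, F x != 0) -> ccontinuous F ->
  ccontinuous (fun x => (F x)^-1).
Proof.
move=> F0 [f1 f2].
have N0 x : Re (F x) ^+ 2 + Im (F x) ^+ 2 != 0.
  by rewrite -cabs_sqr sqrf_eq0; apply: contra (F0 x) => /eqP/cabs_eq0/eqP.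
have cN : continuous (fun x => (Re (F x) ^+ 2 + Im (F x) ^+ 2)^-1).
  move=> x; apply: cvgV; first exact: N0.
  by apply: cvgD; apply: cvgM; [exact: f1|exact: f1|exact: f2|exact: f2].
split.
  rewrite (_ : (fun _ => _) = (fun x => Re (F x) * (Re (F x) ^+ 2 + Im (F x) ^+ 2)^-1)); last first.
    by apply/funext => x; case: (F x).
  by move=> x; apply: cvgM; [exact: f1|exact: cN].
rewrite (_ : (fun _ => _) = (fun x => - (Im (F x) * (Re (F x) ^+ 2 + Im (F x) ^+ 2)^-1))); last first.
  by apply/funext => x; case: (F x).
by move=> x; apply: cvgN; apply: cvgM; [exact: f2|exact: cN].
Qed.

Lemma ccontinuous_qder (f : R[i] -> R[i]) (D : R -> R[i]) : (forall t, qder f t%:C (D t)) ->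
  ccontinuous (fun t => f t%:C).
Proof.
move=> df; split => t; apply: differentiable_continuous; apply/derivable1_diffP.
  by case: (qder_Re (df t)).
by case: (qder_Im (df t)).
Qed.

Lemma ccontinuous_cexp c z : ccontinuous (fun t => cexp (c * t%:C * z)).
Proof.
rewrite (_ : (fun _ => _) = (fun t => cexp ((c * z) * t%:C))); last first.
  by apply/funext => t; rewrite mulrAC.
exact: (ccontinuous_qder (fun t => qder_cexp (c * z) t%:C)).
Qed.

Lemma cintegrableD A F G : measurable A -> cintegrable A F -> cintegrable A G ->
  cintegrable A (fun x => F x + G x).
Proof.
move=> mA [f1 f2] [g1 g2]; split.
  rewrite (_ : (fun _ => _) = (fun x => (Re (F x))%:E + (Re (G x))%:E)%E); last first.
    by apply/funext => x; rewrite cReD.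
  exact: integrableD.
rewrite (_ : (fun _ => _) = (fun x => (Im (F x))%:E + (Im (G x))%:E)%E); last first.
  by apply/funext => x; rewrite cImD.
exact: integrableD.
Qed.

Lemma cintegrableZ A c F : measurable A -> cintegrable A F ->
  cintegrable A (fun x => c * F x).
Proof.
move=> mA [f1 f2]; split.
  rewrite (_ : (fun _ => _) = (fun x => (Re c)%:E * (Re (F x))%:E
    + (- Im c)%:E * (Im (F x))%:E)%E); last first.
    by apply/funext => x; rewrite cReM -EFinM -EFinM -EFinD mulNr.
  by apply: integrableD => //; exact: integrableZl.
rewrite (_ : (fun _ => _) = (fun x => (Re c)%:E * (Im (F x))%:E + (Im c)%:E * (Re (F x))%:E)%E); last first.
  by apply/funext => x; rewrite cImM -EFinM -EFinM -EFinD.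
by apply: integrableD => //; exact: integrableZl.
Qed.

Lemma integrableZ_EFin A (r : R) (g : R -> R) : measurable A ->
  mu.-integrable A (EFin \o g) -> mu.-integrable A (EFin \o (fun x => r * g x)).
Proof.
move=> mA ig; rewrite (_ : _ \o _ = (fun x => r%:E * (EFin \o g) x)%E).
  exact: integrableZl.
by apply/funext.
Qed.

Lemma cintegralD A F G : measurable A -> cintegrable A F -> cintegrable A G ->
  cintegral A (fun x => F x + G x) = cintegral A F + cintegral A G.
Proof.
move=> mA [f1 f2] [g1 g2]; apply: complex_eq; rewrite ?cReD ?cImD /=.
  by under eq_Rintegral do rewrite cReD; exact: RintegralD.
by under eq_Rintegral do rewrite cImD; exact: RintegralD.
Qed.

Lemma cintegralZ A c F : measurable A -> cintegrable A F ->
  cintegral A (fun x => c * F x) = c * cintegral A F.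
Proof.
move=> mA [f1 f2]; apply: complex_eq; rewrite ?cReM ?cImM /=.
  under eq_Rintegral do rewrite cReM.
  rewrite RintegralB//; last 2 first.
  - exact: integrableZ_EFin.
  - exact: integrableZ_EFin.
  by rewrite !RintegralZl.
under eq_Rintegral do rewrite cImM.
rewrite RintegralD//; last 2 first.
- exact: integrableZ_EFin.
- exact: integrableZ_EFin.
by rewrite !RintegralZl.
Qed.

Lemma cintegrableN A F : measurable A -> cintegrable A F ->
  cintegrable A (fun x => - F x).
Proof.
move=> mA iF; have := cintegrableZ (-1) mA iF.
by congr cintegrable; apply/funext => x; rewrite mulN1r.
Qed.

Lemma cintegralN A F : measurable A -> cintegrable A F ->
  cintegral A (fun x => - F x) = - cintegral A F.
Proof.
move=> mA iF; rewrite -mulN1r -cintegralZ//.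
by congr cintegral; apply/funext => x; rewrite mulN1r.
Qed.

Lemma cintegralB A F G : measurable A -> cintegrable A F -> cintegrable A G ->
  cintegral A (fun x => F x - G x) = cintegral A F - cintegral A G.
Proof.
move=> mA iF iG; rewrite cintegralD//; last exact: cintegrableN.
by rewrite cintegralN.
Qed.

Lemma cintegrable_conj A F : measurable A -> cintegrable A F ->
  cintegrable A (fun x => conjc (F x)).
Proof.
move=> mA [f1 f2]; split.
  by rewrite (_ : (fun _ => _) = (fun x => (Re (F x))%:E))//; apply/funext => x; case: (F x).
rewrite (_ : (fun _ => _) = (-%E \o (fun x => (Im (F x))%:E))); first exact: integrableN.
by apply/funext => x /=; case: (F x).
Qed.

Lemma cintegral_conj A F : measurable A -> cintegrable A F ->
  cintegral A (fun x => conjc (F x)) = conjc (cintegral A F).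
Proof.
move=> mA [f1 f2]; apply: complex_eq => /=.
  by congr Rintegral; apply/funext => x; case: (F x).
rewrite -mulN1r -RintegralZl//.
by congr Rintegral; apply/funext => x; case: (F x) => a b; rewrite /= mulN1r.
Qed.

Lemma eq_cintegral A F G : {in A, F =1 G} -> cintegral A F = cintegral A G.
Proof.
by move=> FG; apply: complex_eq => /=; apply: eq_Rintegral => x /FG ->.
Qed.

Lemma cintegrableS A B F : measurable A -> measurable B -> B `<=` A ->
  cintegrable A F -> cintegrable B F.
Proof. by move=> mA mB BA [f1 f2]; split; [exact: integrableS f1|exact: integrableS f2]. Qed.

Lemma ccontinuous_cintegrable u v F : ccontinuous F -> cintegrable `[u, v] F.
Proof.
move=> [f1 f2]; split; apply: continuous_compact_integrable;
  by [exact: segment_compact|exact: continuous_subspaceT].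
Qed.

Lemma cintegral_sum u v n (F : nat -> R -> R[i]) : (forall k, ccontinuous (F k)) ->
  cintegral `[u, v] (fun x => \sum_(k < n) F k x) = \sum_(k < n) cintegral `[u, v] (F k).
Proof.
move=> cF; elim: n => [|n IH].
  rewrite big_ord0 (_ : (fun x => _) = (fun=> 0)); last first.
    by apply/funext => x; rewrite big_ord0.
  by apply: complex_eq => /=; rewrite Rintegral_cst//= mul0r.
rewrite (_ : (fun x => _) = (fun x => \sum_(k < n) F k x + F n x)); last first.
  by apply/funext => x; rewrite big_ord_recr.
rewrite cintegralD; [|by []| |exact: ccontinuous_cintegrable].
  by rewrite IH big_ord_recr.
by apply: ccontinuous_cintegrable; exact: ccontinuous_sum.
Qed.

Lemma ler_norm_Rintegral_itv u v (g : R -> R) (M : R) : u <= v -> continuous g ->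
  (forall x, u <= x <= v -> `|g x| <= M) ->
  `|Rintegral mu `[u, v] g| <= M * (v - u).
Proof.
move=> uv cg gM.
have ig (h : R -> R) : continuous h -> mu.-integrable `[u, v] (EFin \o h).
  move=> ch; apply: continuous_compact_integrable; first exact: segment_compact.
  exact: continuous_subspaceT.
have cn : continuous (fun x => `|g x|).
  by move=> x; apply: cvg_norm; exact: cg.
apply: (le_trans (le_normr_Rintegral _ (ig _ cg))) => //.
have -> : M * (v - u) = Rintegral mu `[u, v] (cst M).
  rewrite Rintegral_cst//= lebesgue_measure_itv /= lte_fin.
  have [uv'|vu] := ltP u v; first by [].
  by rewrite (_ : u = v) ?subrr//; apply/le_anti; rewrite uv.
apply: le_Rintegral; [by []|exact: ig|by apply: ig; exact: cst_continuous|].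
by move=> x; rewrite /= in_itv; exact: gM.
Qed.

(** The factor 2 comes from bounding the real and the imaginary part separately. *)
Lemma ler_cabs_cintegral u v F (M : R) : u <= v -> ccontinuous F ->
  (forall x, u <= x <= v -> cabs (F x) <= M) ->
  cabs (cintegral `[u, v] F) <= 2 * (M * (v - u)).
Proof.
move=> uv [f1 f2] FM; apply: (le_trans (ler_cabs_ReIm _)) => /=.
rewrite mulrDl mul1r; apply: lerD; apply: ler_norm_Rintegral_itv => // x xuv.
  exact: le_trans (ler_Re_cabs _) (FM _ xuv).
exact: le_trans (ler_Im_cabs _) (FM _ xuv).
Qed.

(** A quadratic remainder whose constant and radius are uniform in the parameter integrates to a
    quadratic remainder, so differentiation under the integral sign involves no limit theorem. *)
Lemma qder_cintegral u v (K : R -> R[i] -> R[i]) (K' : R -> R[i]) z (M r : R) :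
  u <= v -> 0 <= M -> 0 < r -> ccontinuous K' ->
  (forall h, cabs h <= r -> ccontinuous (K^~ (z + h))) ->
  (forall h x, cabs h <= r -> u <= x <= v ->
    cabs (K x (z + h) - K x z - K' x * h) <= M * cabs h ^+ 2) ->
  qder (fun w => cintegral `[u, v] (K^~ w)) z (cintegral `[u, v] K').
Proof.
move=> uv M0 r0 cK' cK H; exists (2 * (M * (v - u))), r; split => //.
  by rewrite !mulr_ge0// subr_ge0.
move=> h hr; have cKz : ccontinuous (K^~ z).
  by have := cK 0; rewrite addr0 cabs0; apply; exact: ltW.
have cKh : ccontinuous (fun x => h * K' x) by apply: ccontinuousM => //; exact: ccontinuous_cst.
have cB : ccontinuous (fun x => K x (z + h) - K x z).
  by apply: ccontinuousB => //; exact: cK.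
rewrite (mulrC _ h) -cintegralZ//; last exact: ccontinuous_cintegrable.
rewrite -cintegralB//; [|by apply: ccontinuous_cintegrable; exact: cK|exact: ccontinuous_cintegrable].
rewrite -cintegralB//; [|exact: ccontinuous_cintegrable..].
have -> : 2 * (M * (v - u)) * cabs h ^+ 2 = 2 * ((M * cabs h ^+ 2) * (v - u)) by ring.
apply: ler_cabs_cintegral => //; first exact: ccontinuousB.
by move=> x xuv; rewrite (mulrC h); exact: H.
Qed.

Lemma Rintegral_is_derive u v (g g' : R -> R) : u < v ->
  continuous g' -> (forall x, is_derive x 1 g (g' x)) ->
  Rintegral mu `[u, v] g' = g v - g u.
Proof.
move=> uv cg' dg.
have cg : continuous g.
  by move=> x; apply: differentiable_continuous; apply/derivable1_diffP; case: (dg x).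
rewrite /Rintegral (@continuous_FTC2 _ g' g)//.
- exact: continuous_subspaceT.
- split => [x _||].
  + by case: (dg x).
  + by apply: cvg_at_right_filter; exact: cg.
  + by apply: cvg_at_left_filter; exact: cg.
- by move=> x _; rewrite derive1E; exact: derive_val.
Qed.

Lemma cintegral_qder u v (f : R[i] -> R[i]) (D : R -> R[i]) : u < v ->
  ccontinuous D -> (forall t : R, qder f t%:C (D t)) ->
  cintegral `[u, v] D = f v%:C - f u%:C.
Proof.
move=> uv [c1 c2] df; apply: complex_eq; rewrite ?cReD ?cImD ?cReN ?cImN /=.
  by apply: (@Rintegral_is_derive u v (fun t => Re (f t%:C)) _ uv c1) => x; exact: qder_Re.
by apply: (@Rintegral_is_derive u v (fun t => Im (f t%:C)) _ uv c2) => x; exact: qder_Im.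
Qed.

End ComplexIntegral.

(** * Integrals over a half-line as limits over bounded intervals *)

Section Exhaustion.
Variable R : realType.
Notation mu := (@lebesgue_measure R).

Lemma Rintegral_exhaust d (T : measurableType d) (nu : {measure set T -> \bar R})
  (A : set T) (B : nat -> set T) (g : T -> R) :
  measurable A -> (forall n, measurable (B n)) -> (forall n, B n `<=` A) ->
  (forall x, A x -> \forall n \near \oo, B n x) ->
  nu.-integrable A (EFin \o g) ->
  Rintegral nu (B n) g @[n --> \oo] --> Rintegral nu A g.
Proof.
move=> mA mB BA AB ig.
have /integrableP[mg _] := ig.
rewrite /Rintegral; apply: fine_cvg; rewrite fineK; last exact: integrable_fin_num.
rewrite (_ : (fun n => _) = (fun n => \int[nu]_(x in A) ((EFin \o g) \_ (B n)) x)%E); last first.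
  by apply/funext => n; rewrite -integral_mkcondr (setIidr (BA n)).
apply: (@dominated_cvg _ _ _ nu A mA (fun n => (EFin \o g) \_ (B n)) (EFin \o g) (fun x => `|g x|%:E)) => //.
- move=> n; suff /integrableP[] : nu.-integrable A ((EFin \o g) \_ (B n)) by [].
  apply/integrable_restrict => //; rewrite (setIidr (BA n)).
  exact: integrableS ig.
- move=> x Ax; apply: cvg_near_cst; near=> n.
  rewrite patchE mem_set//; near: n; exact: AB.
- exact: (integrable_abse ig).
- move=> n x Ax; rewrite patchE; case: ifPn => _ //=.
  by rewrite normr0 lee_fin.
Unshelve. all: by end_near. Qed.

(** By dominated convergence an integrable function may be integrated as an improper integral; the
    values on the pieces [B n] will come from a primitive. *)
Lemma cintegral_exhaust (A : set R) (B : nat -> set R) (F : R -> R[i]) (L : R[i]) :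
  measurable A -> (forall n, measurable (B n)) -> (forall n, B n `<=` A) ->
  (forall x, A x -> \forall n \near \oo, B n x) ->
  cintegrable A F ->
  cabs (cintegral (B n) F - L) @[n --> \oo] --> (0 : R) ->
  cintegral A F = L.
Proof.
move=> mA mB BA AB [i1 i2] cL.
have key (g : R -> R) (l : R) : mu.-integrable A (EFin \o g) ->
    (forall n, `|Rintegral mu (B n) g - l| <= cabs (cintegral (B n) F - L)) ->
    Rintegral mu A g = l.
  move=> ig le; have h1 : Rintegral mu (B n) g @[n --> \oo] --> Rintegral mu A g.
    exact: Rintegral_exhaust.
  suff h2 : Rintegral mu (B n) g @[n --> \oo] --> l by rewrite -(cvg_lim _ h1)// (cvg_lim _ h2).
  apply/subr_cvg0/norm_cvg0P.
  apply: squeeze_cvgr (cvg_cst 0) cL; near=> n; by rewrite normr_ge0 le.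
apply: complex_eq => /=; apply: key => // n.
  by apply: le_trans (ler_Re_cabs _); rewrite cReD cReN.
by apply: le_trans (ler_Im_cabs _); rewrite cImD cImN.
Unshelve. all: by end_near. Qed.

Lemma cvg0_expR_nat (y C : R) : 0 < y -> C * expR (- (y * n%:R)) @[n --> \oo] --> 0.
Proof.
move=> y0; rewrite -[X in _ --> X](mulr0 C); apply: cvgMl_tmp.
rewrite (_ : (fun n => _) = (fun n => expR (- y) ^+ n)); last first.
  by apply/funext => n; rewrite -expRM_natr mulNr.
by apply: cvg_expr; rewrite ger0_norm ?expR_ge0// expR_lt1 oppr_lt0.
Qed.

End Exhaustion.

(** * Fourier and Cauchy transforms of a density *)

Section BandTransform.
Variables (R : realType) (u v : R).
Hypothesis uv : u < v.
Implicit Types (z w : R[i]) (x t : R) (phi : R -> R[i]).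
Notation mu := (@lebesgue_measure R).

Definition band phi z := cintegral `[u, v] (fun x => phi x * cexp ('i * x%:C * z)).

(** The kernel 1 / (i (x - z)) is the integral of e^{it(x - z)} over t <= 0 if Im z > 0, and minus
    its integral over t >= 0 if Im z < 0. *)
Definition cauchy_transform phi z := cintegral `[u, v] (fun x => phi x / ('i * (x%:C - z))).

Lemma ccontinuous_bounded phi : ccontinuous phi ->
  exists2 M, 0 <= M & forall x, u <= x <= v -> cabs (phi x) <= M.
Proof.
move=> [c1 c2].
have cn : {within `[u, v], continuous (fun x => `|Re (phi x)| + `|Im (phi x)|)}.
  apply: continuous_subspaceT => x.
  by apply: cvgD; apply: cvg_norm; [exact: c1|exact: c2].
have [c _ cM] := EVT_max (ltW uv) cn.
exists (`|Re (phi c)| + `|Im (phi c)|); first exact: addr_ge0.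
move=> x xuv; apply: (le_trans (ler_cabs_ReIm _)); apply: cM.
by rewrite in_itv.
Qed.

Lemma ccontinuous_band_kernel phi z : ccontinuous phi ->
  ccontinuous (fun x => phi x * cexp ('i * x%:C * z)).
Proof. by move=> cphi; apply: ccontinuousM => //; exact: ccontinuous_cexp. Qed.

Lemma ccontinuous_mulix phi : ccontinuous phi -> ccontinuous (fun x => phi x * ('i * x%:C)).
Proof.
move=> cphi; apply: ccontinuousM => //; apply: ccontinuousM.
  exact: ccontinuous_cst.
by apply: ccontinuous_real => x; exact: cvg_id.
Qed.

Lemma Re_ixz x z : Re ('i * x%:C * z) = - (x * Im z).
Proof. by case: z => a b; rewrite !ReImE /=; ring. Qed.

Lemma qder_band phi z : ccontinuous phi ->
  qder (band phi) z (band (fun x => phi x * ('i * x%:C)) z).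
Proof.
move=> cphi; have [M M0 HM] := ccontinuous_bounded cphi.
pose X := `|u| + `|v|; have X0 : 0 <= X by exact: addr_ge0.
have xX x : u <= x <= v -> `|x| <= X.
  move=> /andP[ux xv]; rewrite /X ler_norml.
  have := ler_norm v; have := ler_norm (- u); rewrite normrN.
  have := normr_ge0 v; have := normr_ge0 u; lra.
(* The radius ensures |x h| <= 1/2, the range of [cexp_taylor1]; [X] bounds |x| on [u, v], so
   |e^{ixz}| is at most e^{X |Im z|}. *)
apply: (@qder_cintegral _ u v (fun x w => phi x * cexp ('i * x%:C * w))
  (fun x => phi x * ('i * x%:C) * cexp ('i * x%:C * z)) z
  (M * (expR (X * `|Im z|) * (3 * X ^+ 2))) (2 * (X + 1))^-1).
- exact: ltW.
- by rewrite !mulr_ge0// expR_ge0.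
- by rewrite invr_gt0; lra.
- by apply: ccontinuous_band_kernel; exact: ccontinuous_mulix.
- by move=> h _; exact: ccontinuous_band_kernel.
move=> h x hr xuv.
have -> : phi x * cexp ('i * x%:C * (z + h)) - phi x * cexp ('i * x%:C * z) -
   phi x * ('i * x%:C) * cexp ('i * x%:C * z) * h =
   phi x * (cexp ('i * x%:C * z) * (cexp ('i * x%:C * h) - 1 - 'i * x%:C * h)).
  by rewrite mulrDr cexpD; ring.
have ixh : cabs ('i * x%:C * h) = `|x| * cabs h by rewrite !cabsM cabsi mul1r cabsR.
have h0 := cabs_ge0 h; have xX' := xX _ xuv.
have K : cabs (cexp ('i * x%:C * h) - 1 - 'i * x%:C * h) <= 3 * X ^+ 2 * cabs h ^+ 2.
  apply: (le_trans (cexp_taylor1 _)); rewrite ixh.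
    apply: (@le_trans _ _ (X * cabs h)); first exact: ler_wpM2r.
    move: hr; rewrite -div1r ler_pdivlMr; last by lra.
    nra.
  by rewrite -mulrA -exprMn ler_wpM2l// lerXn2r ?nnegrE ?mulr_ge0// ler_wpM2r.
rewrite [in leLHS]cabsM [X in _ * X <= _]cabsM -[leRHS]mulrA -[X in _ <= _ * X]mulrA.
apply: ler_pM; rewrite ?mulr_ge0 ?cabs_ge0//; first exact: HM.
apply: ler_pM; rewrite ?cabs_ge0//.
rewrite cabs_cexp Re_ixz ler_expR.
apply: (le_trans (ler_norm _)); rewrite normrN normrM.
exact: ler_wpM2r.
Qed.

Lemma ler_cabs_band phi z M : 0 <= u ->
  ccontinuous phi -> (forall x, u <= x <= v -> cabs (phi x) <= M) ->
  cabs (band phi z) <= 2 * (M * expR (v * `|Im z|) * (v - u)).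
Proof.
move=> u0 cphi HM; apply: ler_cabs_cintegral; first exact: ltW.
  exact: ccontinuous_band_kernel.
move=> x xuv; rewrite cabsM; apply: ler_pM; rewrite ?cabs_ge0//; first exact: HM.
case/andP : xuv => ux xv.
rewrite cabs_cexp Re_ixz ler_expR.
apply: (le_trans (ler_norm _)); rewrite normrN normrM.
by rewrite ler_wpM2r// ger0_norm// (le_trans u0).
Qed.

Lemma ler_cabs_band_real phi t M :
  ccontinuous phi -> (forall x, u <= x <= v -> cabs (phi x) <= M) ->
  cabs (band phi t%:C) <= 2 * (M * (v - u)).
Proof.
move=> cphi HM; apply: ler_cabs_cintegral; first exact: ltW.
  exact: ccontinuous_band_kernel.
move=> x xuv; rewrite cabsM cabs_cexp Re_ixz /= mulr0 oppr0 expR0 mulr1.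
exact: HM.
Qed.

Lemma ccontinuous_band phi : ccontinuous phi -> ccontinuous (fun t => band phi t%:C).
Proof. by move=> cphi; exact: (ccontinuous_qder (fun t => qder_band t%:C cphi)). Qed.

Lemma bandD phi psi z : ccontinuous phi -> ccontinuous psi ->
  band (fun x => phi x + psi x) z = band phi z + band psi z.
Proof.
move=> c1 c2; rewrite /band -cintegralD//; last 2 first.
- by apply: ccontinuous_cintegrable; exact: ccontinuous_band_kernel.
- by apply: ccontinuous_cintegrable; exact: ccontinuous_band_kernel.
by congr cintegral; apply/funext => x; rewrite mulrDl.
Qed.

Lemma bandZ c phi z : ccontinuous phi ->
  band (fun x => c * phi x) z = c * band phi z.
Proof.
move=> c1; rewrite /band -cintegralZ//; last first.
  by apply: ccontinuous_cintegrable; exact: ccontinuous_band_kernel.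
by congr cintegral; apply/funext => x; rewrite mulrA.
Qed.

Lemma band_sum n (phi : nat -> R -> R[i]) z : (forall k, ccontinuous (phi k)) ->
  band (fun x => \sum_(k < n) phi k x) z = \sum_(k < n) band (phi k) z.
Proof.
move=> cphi; rewrite /band.
rewrite -(@cintegral_sum _ u v n (fun k x => phi k x * cexp ('i * x%:C * z))).
  by congr cintegral; apply/funext => x; rewrite mulr_suml.
by move=> k; exact: ccontinuous_band_kernel.
Qed.

(** A block can be moved arbitrarily far without changing the modulus of its density. *)
Lemma band_shift c phi t :
  band (fun x => phi x * cexp ('i * x%:C * (- c)%:C)) t%:C = band phi (t - c)%:C.
Proof.
rewrite /band; congr cintegral; apply/funext => x.
by rewrite -mulrA -cexpD -mulrDr -rmorphD /= (addrC (- c)).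
Qed.

(* [1 / (x - z)] may blow up outside [[u, v]]; clamping [x] makes the kernel
   continuous on the whole line. *)
Let clamp x := Num.max u (Num.min x v).

Let clampE x : u <= x <= v -> clamp x = x.
Proof. by move=> /andP[ux xv]; rewrite /clamp min_l// max_r. Qed.

Let clamp_itv x : u <= clamp x <= v.
Proof. by rewrite /clamp le_max lexx /= ge_max (ltW uv) ge_min lexx orbT. Qed.

Let continuous_clamp : continuous clamp.
Proof.
move=> x; apply: (@continuous_max _ _ (cst u) (fun x => Num.min x v)).
  exact: cst_continuous.
by apply: (@continuous_min _ _ id (cst v)); [exact: cvg_id|exact: cst_continuous].
Qed.

Lemma qder_cauchy_transform phi z d : ccontinuous phi -> 0 < d ->
  (forall x, u <= x <= v -> d <= cabs (x%:C - z)) ->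
  exists D, qder (cauchy_transform phi) z D.
Proof.
move=> cphi d0 Hd; have [M M0 HM] := ccontinuous_bounded cphi.
have hd h x : cabs h <= d / 2 -> u <= x <= v -> d / 2 <= cabs (x%:C - (z + h)).
  move=> hd2 xuv; have := Hd _ xuv.
  have -> : x%:C - z = (x%:C - (z + h)) + h by ring.
  by have := ler_cabsD (x%:C - (z + h)) h; lra.
have ne0 w : 0 < cabs w -> w != 0.
  by move=> w0; apply/eqP => we; rewrite we cabs0 ltxx in w0.
have cK h : cabs h <= d / 2 -> ccontinuous (fun x => ('i * ((clamp x)%:C - (z + h)))^-1).
  move=> hd2; apply: ccontinuousV.
    move=> x; apply: ne0; rewrite cabsM cabsi mul1r.
    by apply: lt_le_trans (hd _ _ hd2 (clamp_itv x)); lra.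
  apply: ccontinuousM; first exact: ccontinuous_cst.
  by apply: ccontinuousB; [exact: ccontinuous_real|exact: ccontinuous_cst].
have cK0 : ccontinuous (fun x => ('i * ((clamp x)%:C - z))^-1).
  by have := cK 0; rewrite addr0 cabs0; apply; lra.
exists (cintegral `[u, v] (fun x => phi x *
  ('i * ('i * ((clamp x)%:C - z))^-1 * ('i * ((clamp x)%:C - z))^-1))).
apply: (@eq_qder _ (fun w => cintegral `[u, v] (fun x => phi x * ('i * ((clamp x)%:C - w))^-1))).
  move=> w; apply: eq_cintegral => x; rewrite inE /= in_itv /= => xuv.
  by rewrite clampE.
apply: (@qder_cintegral _ u v (fun x w => phi x * ('i * ((clamp x)%:C - w))^-1)
   _ z (M * (d ^- 2 * (d / 2)^-1)) (d / 2)).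
- exact: ltW.
- by rewrite !mulr_ge0// ?invr_ge0 ?exprn_ge0 ?mulr_ge0// ltW.
- by lra.
- apply: ccontinuousM => //; apply: ccontinuousM => //; apply: ccontinuousM => //.
  exact: ccontinuous_cst.
- by move=> h hd2; apply: ccontinuousM => //; exact: cK.
move=> h x hd2 xuv; rewrite clampE//.
have s0 := Hd _ xuv; have sh0 := hd _ _ hd2 xuv.
have d2 : 0 < d / 2 by lra.
have s1 : x%:C - z != 0 by apply: ne0; exact: lt_le_trans s0.
have s2 : x%:C - (z + h) != 0 by apply: ne0; exact: lt_le_trans sh0.
have i0 : ('i : R[i]) != 0 by apply: ne0; rewrite cabsi.
(* With s = x - z this is 1/(s - h) - 1/s - h/s^2 = h^2 / (s^2 (s - h)), where |s| >= d and |s - h|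
   >= d/2. *)
have -> : phi x * ('i * (x%:C - (z + h)))^-1 - phi x * ('i * (x%:C - z))^-1 -
  phi x * ('i * ('i * (x%:C - z))^-1 * ('i * (x%:C - z))^-1) * h =
  phi x * (((x%:C - z) ^- 2 * (x%:C - (z + h))^-1) * (h ^+ 2 / 'i)).
  by field; rewrite i0 s1 s2.
have -> : cabs (phi x * ((x%:C - z) ^- 2 * (x%:C - (z + h))^-1 * (h ^+ 2 / 'i))) =
    cabs (phi x) * (cabs (x%:C - z) ^- 2 * (cabs (x%:C - (z + h)))^-1 * cabs h ^+ 2).
  by rewrite (cabsM (phi x)) (cabsM (_ / _)) (cabsM (_ ^- _)) (cabsM (h ^+ 2))
    !cabsV !cabsX cabsi invr1 mulr1.
rewrite -(mulrA M).
apply: ler_pM; [exact: cabs_ge0| |exact: HM|].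
  by rewrite !mulr_ge0 ?invr_ge0 ?exprn_ge0 ?cabs_ge0.
apply: ler_wpM2r; first by rewrite exprn_ge0 ?cabs_ge0.
apply: ler_pM; [by rewrite invr_ge0 exprn_ge0 ?cabs_ge0|by rewrite invr_ge0 cabs_ge0| |].
  rewrite lef_pV2 ?posrE ?exprn_gt0 ?(lt_le_trans d0)//.
  by rewrite lerXn2r ?nnegrE ?cabs_ge0// ltW.
by rewrite lef_pV2 ?posrE// (lt_le_trans d2).
Qed.

End BandTransform.

(** * Integrability by domination *)

Section Integrability.
Variable R : realType.
Implicit Types (F : R -> R[i]) (A : set R).
Notation mu := (@lebesgue_measure R).

Lemma continuous_cabs F : ccontinuous F -> continuous (fun x => cabs (F x)).
Proof.
move=> [f1 f2].
rewrite (_ : (fun _ => _) = (fun x => Num.sqrt (Re (F x) ^+ 2 + Im (F x) ^+ 2))); last first.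
  by apply/funext => x; case: (F x).
move=> x; apply: continuous_comp; last exact: sqrt_continuous.
by apply: cvgD; apply: cvgM; [exact: f1|exact: f1|exact: f2|exact: f2].
Qed.

Lemma le_cintegrable A F (g : R -> R) : measurable A -> ccontinuous F ->
  (forall x, A x -> cabs (F x) <= g x) -> mu.-integrable A (EFin \o g) ->
  cintegrable A F.
Proof.
move=> mA [f1 f2] Fg ig.
have key (h : R -> R) : continuous h -> (forall x, A x -> `|h x| <= g x) ->
    mu.-integrable A (EFin \o h).
  move=> ch hg; apply: le_integrable ig => //.
    apply/measurable_EFinP; apply: measurable_funTS.
    exact: continuous_measurable_fun.
  move=> x Ax; rewrite /= lee_fin; apply: (le_trans (hg _ Ax)); exact: ler_norm.
split; apply: key => // x Ax.
  exact: le_trans (ler_Re_cabs _) (Fg _ Ax).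
exact: le_trans (ler_Im_cabs _) (Fg _ Ax).
Qed.

Lemma cintegrable_cabs A F : measurable A -> ccontinuous F -> cintegrable A F ->
  mu.-integrable A (EFin \o (fun x => cabs (F x))).
Proof.
move=> mA cF [i1 i2].
have ii : mu.-integrable A (fun x => `|(Re (F x))%:E| + `|(Im (F x))%:E|)%E.
  by apply: integrableD => //; exact: integrable_abse.
apply: le_integrable ii => //.
  apply/measurable_EFinP; apply: measurable_funTS.
  by apply: continuous_measurable_fun; exact: continuous_cabs.
move=> x Ax /=; rewrite lee_fin (ger0_norm (cabs_ge0 _)).
exact: le_trans (ler_cabs_ReIm _) (ler_norm _).
Qed.

Lemma cintegrable_subexponential F : ccontinuous F -> cintegrable setT F -> subexponential F.
Proof.
move=> cF iF; have [i1 i2] := iF; split.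
  by split; apply: open_integrable_locally => //; exact: openT.
move=> l l0; have := cintegrable_cabs measurableT cF iF.
move=> /integrableP[_]; apply: le_lt_trans.
have cc := continuous_cabs cF.
apply: ge0_le_integral => //.
- by move=> x _; rewrite lee_fin mulr_ge0 ?cabs_ge0 ?expR_ge0.
- apply/measurable_EFinP; apply: continuous_measurable_fun => x.
  apply: cvgM; first exact: cc.
  apply: continuous_comp; last exact: continuous_expR.
  by apply: cvgM; [exact: cvg_cst|exact: norm_continuous].
- apply/measurable_EFinP; apply: continuous_measurable_fun => x.
  by apply: continuous_comp; [exact: cc|exact: norm_continuous].
- move=> x _; rewrite lee_fin ger0_norm ?cabs_ge0// ler_piMr ?cabs_ge0//.
  by rewrite -expR0 ler_expR mulNr oppr_le0 mulr_ge0// ltW.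
Qed.

End Integrability.

(** * Continuation through the gap *)

Section HalfPlanes.
Variables (R : realType) (u v : R).
Hypothesis uv : u < v.
Implicit Types (z w : R[i]) (t : R) (phi : R -> R[i]).

Let ne_z x z : Im z != 0 -> ('i * (x%:C - z) : R[i]) != 0.
Proof.
move=> z0; rewrite mulf_neq0//.
  by apply/eqP => /(congr1 (@cabs R)); rewrite cabsi cabs0; apply/eqP/oner_neq0.
apply: contra z0 => /eqP/(congr1 (@complex.Im R)).
by rewrite cImD cImN /= add0r => /eqP; rewrite oppr_eq0.
Qed.

Let psi phi z x := phi x / ('i * (x%:C - z)).
Let prim phi z w := cexp ((- 'i * z) * w) * band u v (psi phi z) w.

Let ccontinuous_psi phi z : Im z != 0 -> ccontinuous phi -> ccontinuous (psi phi z).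
Proof.
move=> z0 cphi; apply: ccontinuousM => //; apply: ccontinuousV.
  by move=> x; exact: ne_z.
apply: ccontinuousM; first exact: ccontinuous_cst.
apply: ccontinuousB; last exact: ccontinuous_cst.
by apply: ccontinuous_real => x; exact: cvg_id.
Qed.

(* The primitive of [t |-> e^{-itz} \int phi e^{itx} dx] is obtained by dividing
   the density by [i(x - z)], so no exchange of integrals is needed. *)
Let qder_prim phi z t : Im z != 0 -> ccontinuous phi ->
  qder (prim phi z) t%:C (band u v phi t%:C * cexp ((- t)*i * z)).
Proof.
move=> z0 cphi; have cpsi := ccontinuous_psi z0 cphi.
have := qderM (qder_cexp (- 'i * z) t%:C) (qder_band uv t%:C cpsi).
have -> : cexp ((- t)*i * z) = cexp (- 'i * z * t%:C).
  by congr cexp; apply: complex_eq; rewrite !ReImE /=; ring.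
rewrite (mulrC (- 'i * z)) -(mulrA (cexp _)) -mulrDr -bandZ// -bandD//; last 2 first.
- by apply: ccontinuousM => //; exact: ccontinuous_cst.
- exact: ccontinuous_mulix.
rewrite (mulrC (band _ _ _ _)).
congr (qder _ _ (_ * _)); congr (band _ _ _ _); apply/funext => x.
rewrite (mulrC (- 'i * z)) -mulrDr /psi.
have -> : - 'i * z + 'i * x%:C = 'i * (x%:C - z) by ring.
by rewrite mulfVK// ne_z.
Qed.

(** This boundary term is common to both half-lines: it is the upper end for [Fplus] and, with the
    sign in [Fminus], the lower end there. That is why one formula continues the other. *)
Let prim0 phi z : prim phi z 0%:C = cauchy_transform u v phi z.
Proof.
rewrite /prim mulr0 cexp0 mul1r /band /cauchy_transform; congr cintegral.
by apply/funext => x; rewrite mulr0 cexp0 mulr1.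
Qed.

Let Re_prim z t : Re (- 'i * z * t%:C) = t * Im z.
Proof. by rewrite !ReImE /=; ring. Qed.

(** The primitive thus vanishes at the infinite end of the relevant half-line: at minus infinity if
    Im z > 0, at plus infinity if Im z < 0. *)
Let ler_prim phi z : Im z != 0 -> ccontinuous phi ->
  exists C, forall t, cabs (prim phi z t%:C) <= C * expR (t * Im z).
Proof.
move=> z0 cphi; have cpsi := ccontinuous_psi z0 cphi.
have [M M0 HM] := ccontinuous_bounded uv cpsi.
exists (2 * (M * (v - u))) => t.
rewrite /prim cabsM cabs_cexp Re_prim mulrC ler_wpM2r ?expR_ge0//.
exact: ler_cabs_band_real.
Qed.

Let ccontinuous_integrand phi z : ccontinuous phi ->
  ccontinuous (fun t => band u v phi t%:C * cexp ((- t)*i * z)).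
Proof.
move=> cphi; apply: ccontinuousM; first exact: ccontinuous_band.
rewrite (_ : (fun _ => _) = (fun t => cexp (- 'i * t%:C * z))).
  exact: ccontinuous_cexp.
by apply/funext => t; congr cexp; apply: complex_eq; rewrite !ReImE /=; ring.
Qed.

Lemma Fplus_integrable phi z : ccontinuous phi -> 0 < Im z ->
  cintegrable setT (fun t => band u v phi t%:C) ->
  cintegrable `]-oo, 0] (fun t => band u v phi t%:C * cexp ((- t)*i * z)).
Proof.
move=> cphi z0 ib.
have cI := ccontinuous_integrand z cphi.
have cB := ccontinuous_band uv cphi.
apply: (@le_cintegrable _ _ _ (fun t => cabs (band u v phi t%:C))) => //.
  move=> t At; have t0 : t <= 0 by move: At; rewrite /= in_itv.
  rewrite cabsM ler_piMr ?cabs_ge0// cabs_cexp -expR0 ler_expR.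
  by rewrite !ReImE /=; nra.
apply: cintegrable_cabs => //.
exact: cintegrableS ib.
Qed.

Lemma Fminus_integrable phi z : ccontinuous phi -> Im z < 0 ->
  cintegrable setT (fun t => band u v phi t%:C) ->
  cintegrable `[0, +oo[ (fun t => band u v phi t%:C * cexp ((- t)*i * z)).
Proof.
move=> cphi z0 ib.
have cI := ccontinuous_integrand z cphi.
have cB := ccontinuous_band uv cphi.
apply: (@le_cintegrable _ _ _ (fun t => cabs (band u v phi t%:C))) => //.
  move=> t At; have t0 : 0 <= t by move: At; rewrite /= in_itv /= andbT.
  rewrite cabsM ler_piMr ?cabs_ge0// cabs_cexp -expR0 ler_expR.
  by rewrite !ReImE /=; nra.
apply: cintegrable_cabs => //.
exact: cintegrableS ib.
Qed.

Lemma Fplus_band phi z : ccontinuous phi -> 0 < Im z ->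
  cintegrable setT (fun t => band u v phi t%:C) ->
  Fplus (fun t => band u v phi t%:C) z = cauchy_transform u v phi z.
Proof.
move=> cphi z0 ib; have z0' : Im z != 0 by rewrite gt_eqF.
have [C HC] := ler_prim z0' cphi.
(* The successor keeps the interval nondegenerate at n = 0, as [cintegral_qder] requires. *)
apply: (@cintegral_exhaust _ _ (fun n => `[- n.+1%:R, 0]%classic)) => //.
- by move=> n x; rewrite /= !in_itv /= => /andP[].
- move=> x; rewrite /= in_itv /= => x0; near=> n.
  rewrite /= in_itv /= x0 andbT lerNl.
  rewrite (@le_trans _ _ n%:R)// ?ler_nat//; near: n; exact: nbhs_infty_ger.
- exact: Fplus_integrable.
apply: squeeze_cvgr (cvg_cst 0) (cvg0_expR_nat C z0); near=> n.
apply/andP; split; first exact: cabs_ge0.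
rewrite (cintegral_qder _ _ (fun t => qder_prim t z0' cphi)); last 2 first.
- by rewrite oppr_lt0.
- exact: ccontinuous_integrand.
rewrite prim0 addrAC subrr add0r cabsN.
have C0 : 0 <= C.
  have := HC 0; rewrite mul0r expR0 mulr1; apply: le_trans; exact: cabs_ge0.
apply: (le_trans (HC _)); rewrite ler_wpM2l// ler_expR mulNr lerN2 mulrC.
by rewrite ler_pM2r// ler_nat.
Unshelve. all: by end_near. Qed.

Lemma Fminus_band phi z : ccontinuous phi -> Im z < 0 ->
  cintegrable setT (fun t => band u v phi t%:C) ->
  Fminus (fun t => band u v phi t%:C) z = cauchy_transform u v phi z.
Proof.
move=> cphi z0 ib; have z0' : Im z != 0 by rewrite lt_eqF.
have [C HC] := ler_prim z0' cphi.
have z1 : 0 < - Im z by rewrite oppr_gt0.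
rewrite /Fminus -[RHS]opprK; congr (- _).
apply: (@cintegral_exhaust _ _ (fun n => `[0, n.+1%:R]%classic)) => //.
- by move=> n x; rewrite /= !in_itv /= => /andP[->].
- move=> x; rewrite /= in_itv /= andbT => x0; near=> n.
  rewrite /= in_itv /= x0 /=.
  rewrite (@le_trans _ _ n%:R)// ?ler_nat//; near: n; exact: nbhs_infty_ger.
- exact: Fminus_integrable.
apply: squeeze_cvgr (cvg_cst 0) (cvg0_expR_nat C z1); near=> n.
apply/andP; split; first exact: cabs_ge0.
rewrite (cintegral_qder _ _ (fun t => qder_prim t z0' cphi)); last 2 first.
- by [].
- exact: ccontinuous_integrand.
rewrite prim0 opprK subrK.
have C0 : 0 <= C.
  have := HC 0; rewrite mul0r expR0 mulr1; apply: le_trans; exact: cabs_ge0.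
apply: (le_trans (HC _)); rewrite ler_wpM2l// ler_expR mulNr opprK mulrC.
by rewrite ler_nM2l// ler_nat.
Unshelve. all: by end_near. Qed.

End HalfPlanes.

(** * The real entire function attached to a density *)

Section RealPart.
Variables (R : realType) (a b : R).
Hypotheses (a0 : 0 < a) (ab : a < b).
Variable phi : R -> R[i].
Hypothesis cphi : ccontinuous phi.
Hypothesis iphi : cintegrable setT (fun t => band a b phi t%:C).
Implicit Types (z w : R[i]) (t : R).

Let E := band a b phi.

Definition real_band z := band a b phi z + conjc (band a b phi (conjc z)).

Lemma real_bandE t : real_band t%:C = (2 * Re (band a b phi t%:C))%:C.
Proof.
rewrite /real_band conjc_real; case: (band _ _ _ _) => x y.
by apply: complex_eq => /=; ring.
Qed.

Lemma qder_real_band z : exists D, qder real_band z D.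
Proof.
eexists; apply: qderD; first exact: qder_band.
by apply: (qder_conj (f := E)); exact: qder_band.
Qed.

Lemma real_entire_real_band : real_entire real_band.
Proof.
split; last by move=> x; rewrite real_bandE.
move=> z _; have [D fD] := qder_real_band z; exact: qder_derivable fD.
Qed.

Lemma exponential_type_real_band : exponential_type b real_band.
Proof.
move=> e e0; have [M M0 HM] := ccontinuous_bounded ab cphi.
have b0 : 0 <= b by rewrite ltW// (lt_trans a0).
have key z : cabs (band a b phi z) <= 2 * (M * (b - a)) * expR ((b + e) * cabs z).
  apply: (le_trans (ler_cabs_band ab z (ltW a0) cphi HM)).
  rewrite -!mulrA; do 2 apply: ler_wpM2l => //.
  rewrite mulrC; apply: ler_wpM2l; first by rewrite subr_ge0 ltW.
  rewrite ler_expR; have := ler_Im_cabs z; have := normr_ge0 (Im z); nra.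
exists (2 * (2 * (M * (b - a)))) => z.
apply: (le_trans (ler_cabsD _ _)); rewrite cabs_conj.
have := key z; have := key (conjc z); rewrite cabs_conj; lra.
Qed.

Lemma bounded_real_band : exists M : R, forall x : R, cabs (real_band x%:C) <= M.
Proof.
have [M M0 HM] := ccontinuous_bounded ab cphi.
exists (2 * (2 * (M * (b - a)))) => x.
apply: (le_trans (ler_cabsD _ _)); rewrite cabs_conj conjc_real.
by have := ler_cabs_band_real ab x cphi HM; lra.
Qed.

Let real_band_real t : real_band t%:C = E t%:C + conjc (E t%:C).
Proof. by rewrite /real_band conjc_real. Qed.

Let ccontinuous_E := ccontinuous_band ab cphi.

Lemma cintegrable_real_band : cintegrable setT (fun t => real_band t%:C).
Proof.
rewrite (_ : (fun t => _) = (fun t => E t%:C + conjc (E t%:C))); last exact/funext.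
by apply: cintegrableD => //; exact: cintegrable_conj.
Qed.

Let ccontinuous_real_band : ccontinuous (fun t => real_band t%:C).
Proof.
have H t := cid (qder_real_band t%:C).
exact: (ccontinuous_qder (fun t => projT2 (H t))).
Qed.

Lemma conj_cexp z : conjc (cexp z) = cexp (conjc z).
Proof. by case: z => x y; rewrite /cexp /= cosN sinN mulrN. Qed.

Lemma conjM z w : conjc (z * w) = conjc z * conjc w.
Proof. exact: rmorphM. Qed.

Lemma conjN z : conjc (- z) = - conjc z.
Proof. exact: rmorphN. Qed.

(** The conjugate of e^{-itw} at w = - conj z is e^{-itz}. The reflection preserves each half-plane
    and the strip |Re z| < a, so the conjugate term, with frequencies in [-b, -a], reduces to the
    same Cauchy transform. *)
Let reflect z := - conjc z.

Let integrandE z t : real_band t%:C * cexp ((- t)*i * z) =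
  E t%:C * cexp ((- t)*i * z) + conjc (E t%:C * cexp ((- t)*i * reflect z)).
Proof.
rewrite real_band_real mulrDl; congr (_ + _).
rewrite conjM conj_cexp; congr (_ * cexp _).
by case: z => x y; apply: complex_eq; rewrite /reflect /= ?ReImE /=; ring.
Qed.

Let Im_reflect z : Im (reflect z) = Im z.
Proof. by case: z => x y /=; rewrite opprK. Qed.

Let Re_reflect z : Re (reflect z) = - Re z.
Proof. by case: z. Qed.

Let G z := cauchy_transform a b phi z + conjc (cauchy_transform a b phi (reflect z)).

Let Fplus_real_band z : 0 < Im z -> Fplus (fun t => real_band t%:C) z = G z.
Proof.
move=> z0; rewrite /Fplus.
rewrite (eq_cintegral (G := fun t => E t%:C * cexp ((- t)*i * z) +
  conjc (E t%:C * cexp ((- t)*i * reflect z)))); last by move=> t _; exact: integrandE.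
have i1 := Fplus_integrable ab cphi z0 iphi.
have z1 : 0 < Im (reflect z) by rewrite Im_reflect.
have i2 := Fplus_integrable ab cphi z1 iphi.
rewrite cintegralD//; last exact: cintegrable_conj.
rewrite cintegral_conj//; congr (_ + conjc _); exact: Fplus_band.
Qed.

Let Fminus_real_band z : Im z < 0 -> Fminus (fun t => real_band t%:C) z = G z.
Proof.
move=> z0; rewrite /Fminus.
rewrite (eq_cintegral (G := fun t => E t%:C * cexp ((- t)*i * z) +
  conjc (E t%:C * cexp ((- t)*i * reflect z)))); last by move=> t _; exact: integrandE.
have i1 := Fminus_integrable ab cphi z0 iphi.
have z1 : Im (reflect z) < 0 by rewrite Im_reflect.
have i2 := Fminus_integrable ab cphi z1 iphi.
rewrite cintegralD//; last exact: cintegrable_conj.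
rewrite cintegral_conj// opprD -conjN; congr (_ + conjc _); exact: Fminus_band.
Qed.

Let qder_cauchy_domain z : Im z != 0 \/ (- a < Re z) && (Re z < a) ->
  exists D, qder (cauchy_transform a b phi) z D.
Proof.
case=> [z0|/andP[_ za]].
  apply: (@qder_cauchy_transform _ _ _ ab _ _ `|Im z|) => //; first by rewrite normr_gt0.
  move=> x _; apply: le_trans (ler_Im_cabs _).
  by rewrite cImD cImN /= add0r normrN.
apply: (@qder_cauchy_transform _ _ _ ab _ _ (a - Re z)) => //; first by rewrite subr_gt0.
move=> x /andP[ax _]; apply: le_trans (Re_le_cabs _).
by rewrite cReD cReN /= lerD2r.
Qed.

Lemma spectral_gap_real_band : spectral_gap a (fun t => real_band t%:C).
Proof.
split; first by apply: cintegrable_subexponential => //; exact: cintegrable_real_band.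
exists G; split; last 2 first.
- by move=> z z0; rewrite Fplus_real_band.
- by move=> z z0; rewrite Fminus_real_band.
move=> z /= zD; have [D HD] := qder_cauchy_domain zD.
have [|D' HD'] := @qder_cauchy_domain (- (conjc z)).
  move: zD; rewrite -/(reflect z) Im_reflect Re_reflect.
  by rewrite ltrN2 (ltrNl a) andbC.
(* The reflection and the outer conjugation are both antiholomorphic, so the second term is complex
   differentiable. *)
have HG := qderD HD (qder_conj (qder_opp HD')).
by apply: qder_derivable; exact: HG.
Qed.

End RealPart.

(** * Superoscillation *)

Section Superoscillation.
Variable R : realType.
Implicit Types (z w : R[i]) (t L B s d : R).

(** An error [d] in one factor grows to about n d in the n-th power, which is small because [d] will
    be of order 1 / n^2. *)
Lemma ler_cabs_exp_sub1 w d n : cabs (w - 1) <= d ->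
  cabs (w ^+ n - 1) <= (1 + d) ^+ n - 1.
Proof.
move=> wd; have d0 : 0 <= d by exact: le_trans (cabs_ge0 _) wd.
have w1 : cabs w <= 1 + d.
  have -> : w = 1 + (w - 1) by ring.
  by rewrite (le_trans (ler_cabsD _ _))// cabs1 lerD2l.
elim: n => [|n IH]; first by rewrite !expr0 !subrr cabs0.
have -> : w ^+ n.+1 - 1 = w ^+ n * (w - 1) + (w ^+ n - 1) by rewrite exprSr; ring.
apply: (le_trans (ler_cabsD _ _)).
have -> : (1 + d) ^+ n.+1 - 1 = (1 + d) ^+ n * d + ((1 + d) ^+ n - 1) by rewrite exprSr; ring.
apply: lerD => //; rewrite cabsM cabsX; apply: ler_pM => //.
- by rewrite exprn_ge0 ?cabs_ge0.
- exact: cabs_ge0.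
- by rewrite lerXn2r ?nnegrE ?cabs_ge0// addr_ge0.
Qed.

Lemma superoscillation_factor B t :
  cabs (cexp ('i * (- (B * t))%:C) * (1 + B%:C * (cexp ('i * t%:C) - 1)) - 1) <=
  2 * (`|B| + B ^+ 2) * t ^+ 2.
Proof.
(* The linear terms i B t of the two expansions cancel, leaving two second-order remainders. *)
have -> : cexp ('i * (- (B * t))%:C) * (1 + B%:C * (cexp ('i * t%:C) - 1)) - 1 =
  cexp ('i * (- (B * t))%:C) *
   (B%:C * (cexp ('i * t%:C) - 1 - 'i * t%:C) -
   (cexp ('i * (B * t)%:C) - 1 - 'i * (B * t)%:C)).
  have E : cexp ('i * (- (B * t))%:C) * cexp ('i * (B * t)%:C) = 1.
    by rewrite -cexpD -mulrDr -rmorphD /= addNr mulr0 cexp0.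
  rewrite -[X in _ - X = _]E; move: (cexp _) (cexp _) (cexp _) => X Y Z.
  rewrite rmorphM /=; ring.
rewrite cabsM cabs_cexp_imag mul1r.
apply: (le_trans (ler_cabsB _ _)); rewrite cabsM cabsR.
have h1 := cexp_imag_taylor1 t; have h2 := cexp_imag_taylor1 (B * t).
have h3 : `|B| * cabs (cexp ('i * t%:C) - 1 - 'i * t%:C) <= `|B| * (2 * t ^+ 2).
  exact: ler_wpM2l.
move: h2; rewrite exprMn; lra.
Qed.

(** The weights of (1 - B + B e^z)^n; they add up to 1, but alternate in sign when B < 0. *)
Definition superosc_coef B n k : R := 'C(n, k)%:R * (B ^+ k * (1 - B) ^+ (n - k)).

Lemma superoscillation_sum B z n :
  \sum_(k < n.+1) (superosc_coef B n k)%:C * cexp (z *+ k) =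
  (1 + B%:C * (cexp z - 1)) ^+ n.
Proof.
have -> : 1 + B%:C * (cexp z - 1) = (1 - B)%:C + B%:C * cexp z.
  by rewrite rmorphB rmorph1; ring.
rewrite exprDn; apply: eq_bigr => k _.
rewrite /superosc_coef 2!rmorphM 2!rmorphXn rmorph_nat cexp_nat exprMn -mulr_natl.
ring.
Qed.

(* [1 + B(e^{iy}-1)] agrees with [e^{iBy}] to second order at [y = 0]. *)
Lemma superoscillation B s L : 0 < s -> exists n : nat, [/\ (0 < n)%N &
  forall t, `|t| <= L ->
  cabs (\sum_(k < n.+1) (superosc_coef B n k)%:C *
     cexp ('i * ((- (B * s) + s * k%:R / n%:R) * t)%:C) - 1) <= 4^-1].
Proof.
move=> s0.
pose c := 2 * (`|B| + B ^+ 2) * (s * L) ^+ 2.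
have B0 : 0 <= 2 * (`|B| + B ^+ 2).
  by apply: mulr_ge0 => //; apply: addr_ge0 => //; exact: sqr_ge0.
have c0 : 0 <= c by exact: mulr_ge0 B0 (sqr_ge0 _).
(* With h = st/n one factor errs by at most c / n^2, so the n factors together lose at most c / n <=
   1/8 in the exponent, and e^{1/8} - 1 <= 1/4. *)
pose n := (Num.truncn (8 * c)).+1.
exists n; split => // t tL.
have n0 : 0 < n%:R :> R by rewrite ltr0n.
have n0' : n%:R != 0 :> R by rewrite gt_eqF.
have nc : 8 * c <= n%:R by rewrite ltW// truncnS_gt.
pose h := s * t / n%:R.
have -> : \sum_(k < n.+1) (superosc_coef B n k)%:C *
     cexp ('i * ((- (B * s) + s * k%:R / n%:R) * t)%:C) =
   (cexp ('i * (- (B * h))%:C) * (1 + B%:C * (cexp ('i * h%:C) - 1))) ^+ n.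
  rewrite exprMn -superoscillation_sum mulr_sumr; apply: eq_bigr => k _.
  rewrite mulrCA -cexp_nat -cexpD; congr (_ * cexp _).
  rewrite -!mulrnAr -mulrDr -!rmorphMn -rmorphD /=; congr (_ * _%:C).
  by rewrite -(mulr_natr (- (B * h)) n) -(mulr_natr h k) /h; field.
have F := superoscillation_factor B h.
set d := 2 * (`|B| + B ^+ 2) * h ^+ 2 in F.
apply: (le_trans (ler_cabs_exp_sub1 n F)).
have d0 : 0 <= d by exact: mulr_ge0 B0 (sqr_ge0 _).
have dn : d * n%:R <= 8^-1.
  have -> : d * n%:R = 2 * (`|B| + B ^+ 2) * (s * t) ^+ 2 / n%:R.
    by rewrite /d /h; field.
  rewrite ler_pdivrMr//; apply: (@le_trans _ _ c); last by lra.
  apply: (ler_wpM2l B0).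
  rewrite !exprMn; apply: ler_wpM2l; first exact: sqr_ge0.
  rewrite -(real_normK (num_real t)) lerXn2r ?nnegrE//.
  exact: le_trans tL.
have e1 : (1 + d) ^+ n <= expR (d * n%:R).
  rewrite expRM_natr lerXn2r ?nnegrE ?addr_ge0 ?expR_ge0//; exact: expR_ge1Dx.
have dn0 : 0 <= d * n%:R by rewrite mulr_ge0.
have : `|d * n%:R| <= 2^-1 by rewrite ger0_norm//; lra.
move=> /expR_sub1; rewrite ler_norml => /andP[_].
nra.
Qed.

End Superoscillation.

(** * A narrow bump and its transform *)

Section Bump.
Variables (R : realType) (a b : R).
Hypothesis ab : a < b.
Implicit Types (x t d c : R).
Notation mu := (@lebesgue_measure R).

(** Being quadratic on its support, it has a transform with an explicit primitive; vanishing at the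
    ends of the support, it has one that decays like 1 / t^2. *)
Definition parabola d x := Num.max 0 (d ^+ 2 - x ^+ 2).

Lemma continuous_parabola d c : continuous (fun x => parabola d (x - c)).
Proof.
move=> x; apply: (@continuous_max _ _ (cst 0) (fun x => d ^+ 2 - (x - c) ^+ 2)).
  exact: cst_continuous.
apply: cvgB; first exact: cvg_cst.
by apply: cvgM; (apply: cvgB; [exact: cvg_id|exact: cvg_cst]).
Qed.

Lemma parabola_ge0 d x : 0 <= parabola d x.
Proof. by rewrite /parabola le_max lexx. Qed.

Lemma parabola_le d x : parabola d x <= d ^+ 2.
Proof. by rewrite /parabola ge_max sqr_ge0 /= lerBlDr lerDl sqr_ge0. Qed.

Lemma parabola_out d x : 0 < d -> ~~ (- d <= x <= d) -> parabola d x = 0.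
Proof.
move=> d0 xd; apply/max_idPl; rewrite subr_le0.
rewrite -(real_normK (num_real x)) lerXn2r ?nnegrE// ?ltW//.
by rewrite real_ltNge ?num_real// ler_norml.
Qed.

Lemma parabola_in d x : - d <= x <= d -> parabola d x = d ^+ 2 - x ^+ 2.
Proof. by move=> /andP[x1 x2]; apply/max_idPr; nra. Qed.

Lemma ccontinuous_parabola d c : ccontinuous (fun x => (parabola d (x - c))%:C).
Proof. by apply: ccontinuous_real; exact: continuous_parabola. Qed.

(** The truncated function is not differentiable at its corners; on the smaller interval it is a
    polynomial and primitives can be written down. *)
Lemma band_parabola_restrict d c (F : R -> R[i]) : 0 < d -> a <= c - d -> c + d <= b ->
  cintegral `[a, b] (fun x => (parabola d (x - c))%:C * F x) =
  cintegral `[c - d, c + d] (fun x => (parabola d (x - c))%:C * F x).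
Proof.
move=> d0 ac cb.
have sub : `[c - d, c + d]%classic `<=` `[a, b]%classic.
  by apply: subset_itvScc; rewrite bnd_simp.
have key (G : R -> R) : (forall x, ~~ (- d <= x - c <= d) -> G x = 0) ->
    Rintegral mu `[a, b] G = Rintegral mu `[c - d, c + d] G.
  move=> G0; rewrite -[in RHS](setIidr sub) Rintegral_mkcondr.
  apply: eq_Rintegral => x _; rewrite patchE; case: ifPn => // xn.
  apply: G0; move: xn; apply: contra => /andP[x1 x2].
  by rewrite inE /= in_itv /=; apply/andP; split; lra.
apply: complex_eq => /=; apply: key => x /(parabola_out d0) ->.
  by rewrite mul0r.
by rewrite mul0r.
Qed.

(** Repeated integration by parts, which stops because p is quadratic: with T = 1/(it), the
    primitive [V] is (T p - T^2 p' + T^3 p'') e^{itw}. At the ends p vanishes, and each end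
    contributes at most (2 d + 2) / t^2. *)
Lemma ler_cabs_band_parabola d c t : 0 < d -> a <= c - d -> c + d <= b -> 1 <= `|t| ->
  cabs (band a b (fun x => (parabola d (x - c))%:C) t%:C) <= (4 * d + 4) / t ^+ 2.
Proof.
move=> d0 ac cb t1.
have t0 : t != 0 by apply/eqP => te; move: t1; rewrite te normr0 ler10.
have t0' : (t%:C : R[i]) != 0 by rewrite eq_complex /= negb_and t0.
have i0 : ('i : R[i]) != 0 by rewrite eq_complex /= oner_eq0 andbF.
rewrite /band band_parabola_restrict//.
pose T := (('i * t%:C)^-1 : R[i]).
pose p (w : R[i]) := (d ^+ 2)%:C - (w - c%:C) * (w - c%:C).
pose p1 (w : R[i]) := -2 * (w - c%:C).
pose V (w : R[i]) := (T * p w - T ^+ 2 * p1 w + T ^+ 3 * (-2)) * cexp ('i * t%:C * w).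
have dl w : qder (fun w => w - c%:C) w 1.
  by have := qderD (qder_id w) (qder_cst (- c%:C) w); rewrite addr0.
have dp w : qder p w (p1 w).
  have := qderD (qder_cst (d ^+ 2)%:C w) (qderZ (-1) (qderM (dl w) (dl w))).
  rewrite /p /p1 (_ : 0 + _ = -2 * (w - c%:C)); last by ring.
  by apply: eq_qder => y; rewrite mulN1r.
have dp1 w : qder p1 w (-2).
  by have := qderZ (-2) (dl w); rewrite mulr1.
have dV w : qder V w (p w * cexp ('i * t%:C * w)).
  have dq : qder (fun w => T * p w + (- T ^+ 2) * p1 w + T ^+ 3 * (-2)) w
      (T * p1 w + (- T ^+ 2) * (-2) + 0).
    apply: qderD; last exact: qder_cst.
    by apply: qderD; apply: qderZ.
  have := qderM dq (qder_cexp ('i * t%:C) w).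
  congr (qder _ _ _).
    by apply/funext => y; rewrite mulNr.
  have -> : 'i * t%:C = T^-1 by rewrite invrK.
  have T0 : T != 0 by rewrite invr_eq0 mulf_neq0.
  by field.
rewrite (eq_cintegral (G := fun x => p x%:C * cexp ('i * t%:C * x%:C))); last first.
  move=> x; rewrite inE /= in_itv /= => /andP[x1 x2].
  rewrite parabola_in; last by apply/andP; split; lra.
  rewrite (mulrAC 'i) /p; congr (_ * _).
  by rewrite rmorphB !rmorphXn rmorphB expr2.
rewrite (cintegral_qder _ _ (fun x => dV x%:C)); last 2 first.
- lra.
- exact: (ccontinuous_qder (fun x => qderM (dp x%:C) (qder_cexp ('i * t%:C) x%:C))).
have n0 : 0 < `|t| by rewrite normr_gt0.
have cT : cabs T = `|t|^-1 by rewrite /T cabsV cabsM cabsi mul1r cabsR.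
have HV x : `|x - c| = d -> cabs (V x%:C) <= (2 * d + 2) / t ^+ 2.
  move=> xd; rewrite /V cabsM.
  have -> : p x%:C = 0.
    rewrite /p -rmorphB -rmorphM -rmorphB /= -xd real_normK ?num_real// -expr2 subrr.
    by [].
  rewrite -mulrA -rmorphM cabs_cexp_imag mulr1 mulr0 add0r.
  apply: (le_trans (ler_cabsD _ _)); rewrite cabsN !cabsM ?cabsX cT /p1 ?cabsM -rmorphB cabsR xd.
  have -> : cabs (-2 : R[i]) = 2.
    by rewrite cabsN (_ : (2 : R[i]) = 2%:C) ?cabsR ?normr_nat// rmorph_nat.
  rewrite -(real_normK (num_real t)) -exprVn.
  have : `|t|^-1 ^+ 3 <= `|t|^-1 ^+ 2.
    rewrite exprSr ler_piMr ?exprn_ge0 ?invr_ge0// invf_le1//.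
  have : 0 <= `|t|^-1 ^+ 2 by rewrite exprn_ge0 ?invr_ge0.
  nra.
apply: (le_trans (ler_cabsB _ _)).
have h1 : cabs (V (c + d)%:C) <= (2 * d + 2) / t ^+ 2.
  by apply: HV; rewrite addrAC subrr add0r gtr0_norm.
have h2 : cabs (V (c - d)%:C) <= (2 * d + 2) / t ^+ 2.
  by apply: HV; rewrite addrAC subrr add0r normrN gtr0_norm.
lra.
Qed.

Lemma cintegral_parabola d c : 0 < d -> a <= c - d -> c + d <= b ->
  cintegral `[c - d, c + d] (fun x => (parabola d (x - c))%:C) = (4 / 3 * d ^+ 3)%:C.
Proof.
move=> d0 ac cb.
pose l (w : R[i]) := w - c%:C.
pose V (w : R[i]) := (d ^+ 2)%:C * l w - 3^-1 * (l w * l w * l w).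
have dl w : qder l w 1.
  by have := qderD (qder_id w) (qder_cst (- c%:C) w); rewrite addr0.
have dV w : qder V w ((d ^+ 2)%:C - l w ^+ 2).
  have := qderD (qderZ (d ^+ 2)%:C (dl w))
    (qderZ (- 3^-1) (qderM (qderM (dl w) (dl w)) (dl w))).
  rewrite (_ : _ + _ = (d ^+ 2)%:C - l w ^+ 2); last by field.
  by apply: eq_qder => y; rewrite /V mulNr.
rewrite (eq_cintegral (G := fun x => (d ^+ 2)%:C - l x%:C ^+ 2)); last first.
  move=> x; rewrite inE /= in_itv /= => /andP[x1 x2].
  rewrite parabola_in; last by apply/andP; split; lra.
  by rewrite /l rmorphB !rmorphXn rmorphB.
rewrite (cintegral_qder _ _ (fun x => dV x%:C)); last 2 first.
- lra.
- have := ccontinuous_real (R := R) (g := fun x => d ^+ 2 - (x - c) ^+ 2).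
  rewrite (_ : (fun x => (d ^+ 2 - (x - c) ^+ 2)%:C) = (fun x => (d ^+ 2)%:C - l x%:C ^+ 2)).
    apply; move=> x; apply: cvgB; first exact: cvg_cst.
    by apply: cvgM; (apply: cvgB; [exact: cvg_id|exact: cvg_cst]).
  by apply/funext => x; rewrite /l rmorphB !rmorphXn rmorphB.
have E3 : (3^-1 : R[i]) = (3^-1 : R)%:C by rewrite fmorphV rmorph_nat.
rewrite /V /l E3 -!rmorphB -!rmorphM -!rmorphB; congr (_%:C).
by field.
Qed.

(** A narrow bump acts like its mass placed at [c]. The support has length 2 d, the height is at
    most d^2 and the phase moves by at most 2 d |t|, so against the mass 4/3 d^3 the relative error
    is of order d |t|. *)
Lemma band_parabola_approx d c t : 0 < d -> a <= c - d -> c + d <= b ->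
  cabs (band a b (fun x => (parabola d (x - c))%:C) t%:C
    - (4 / 3 * d ^+ 3)%:C * cexp ('i * (c * t)%:C)) <= 8 * d ^+ 4 * `|t|.
Proof.
move=> d0 ac cb; rewrite /band band_parabola_restrict// -(cintegral_parabola d0 ac cb).
have cparabola := ccontinuous_parabola d c.
rewrite mulrC -cintegralZ//; last exact: ccontinuous_cintegrable.
have cc0 : ccontinuous (fun x => cexp ('i * (c * t)%:C) * (parabola d (x - c))%:C).
  by apply: ccontinuousM => //; exact: ccontinuous_cst.
have cc1 : ccontinuous (fun x => (parabola d (x - c))%:C * cexp ('i * x%:C * t%:C)).
  by exact: ccontinuous_band_kernel.
rewrite -cintegralB//; [|exact: ccontinuous_cintegrable..].
have -> : 8 * d ^+ 4 * `|t| = 2 * ((d ^+ 2 * (2 * (d * `|t|))) * (c + d - (c - d))) by ring.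
apply: ler_cabs_cintegral; [lra|exact: ccontinuousB|].
move=> x /andP[x1 x2].
have -> : (parabola d (x - c))%:C * cexp ('i * x%:C * t%:C) -
    cexp ('i * (c * t)%:C) * (parabola d (x - c))%:C =
    (parabola d (x - c))%:C * (cexp ('i * (c * t)%:C) * (cexp ('i * ((x - c) * t)%:C) - 1)).
  have -> : 'i * x%:C * t%:C = 'i * (c * t)%:C + 'i * ((x - c) * t)%:C.
    by rewrite !(rmorphM, rmorphB) /=; ring.
  rewrite cexpD; ring.
rewrite cabsM cabsR (ger0_norm (parabola_ge0 _ _)); apply: ler_pM => //.
- exact: parabola_ge0.
- exact: cabs_ge0.
- exact: parabola_le.
rewrite cabsM cabs_cexp_imag mul1r; apply: (le_trans (cexp_imag_sub1 _)).
rewrite normrM ler_wpM2l// ler_wpM2r// ler_norml; apply/andP; split; lra.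
Qed.

Lemma ler_cabs_band_parabola_sqr d c : 0 < d -> a <= c - d -> c + d <= b ->
  exists K, forall t,
  cabs (band a b (fun x => (parabola d (x - c))%:C) t%:C) <= K / (1 + t ^+ 2).
Proof.
move=> d0 ac cb; pose M := 2 * (d ^+ 2 * (b - a)).
have M0 : 0 <= M.
  by apply: mulr_ge0 => //; apply: mulr_ge0; [exact: sqr_ge0|rewrite subr_ge0 ltW].
(* For |t| >= 1 one has 1 + t^2 <= 2 t^2 and the decay applies; for |t| < 1 one has 1 + t^2 <= 2 and
   the uniform bound [M] suffices. *)
exists (2 * (4 * d + 4) + 2 * M) => t.
have t2 : 0 < 1 + t ^+ 2 by have := sqr_ge0 t; lra.
rewrite ler_pdivlMr//.
have [t1|t1] := leP 1 `|t|.
  have := ler_cabs_band_parabola d0 ac cb t1.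
  have t3 : 1 <= t ^+ 2 by rewrite -(real_normK (num_real t)) expr_ge1.
  rewrite ler_pdivlMr; last by lra.
  have := cabs_ge0 (band a b (fun x => (parabola d (x - c))%:C) t%:C).
  nra.
have H : cabs (band a b (fun x => (parabola d (x - c))%:C) t%:C) <= M.
  apply: ler_cabs_band_real => //; first exact: ccontinuous_parabola.
  by move=> x _; rewrite cabsR (ger0_norm (parabola_ge0 _ _)) parabola_le.
have t3 : t ^+ 2 <= 1 by rewrite -(real_normK (num_real t)) expr_le1// ltW.
have := cabs_ge0 (band a b (fun x => (parabola d (x - c))%:C) t%:C).
nra.
Qed.

End Bump.

(** * One block, positive on a prescribed interval *)

Section Block.
Variables (R : realType) (a b : R).
Hypothesis ab : a < b.
Implicit Types (x t d L : R).

(** One constant [C] bounds both the density and the decay; it may grow with [L] in any manner,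
    since the weights in the final sum are chosen after it. *)
Lemma positive_block L : 0 < L -> exists (phi : R -> R[i]) (C : R),
  [/\ ccontinuous phi, 1 <= C, forall x, cabs (phi x) <= C,
      forall t, cabs (band a b phi t%:C) <= C / (1 + t ^+ 2) &
      forall t, `|t| <= L -> 1 <= Re (band a b phi t%:C)].
Proof.
(* The frequencies fill the middle half of [a, b], which leaves a margin (b - a) / 4 on either side
   for the bumps. *)
move=> L0; pose s := (b - a) / 2; pose al := a + (b - a) / 4; pose B := - al / s.
have s0 : 0 < s by rewrite divr_gt0// subr_gt0.
have [n [n0 Hn]] := superoscillation B L s0.
have nR : 0 < n%:R :> R by rewrite ltr0n.
pose kap := superosc_coef B n; pose S := \sum_(k < n.+1) `|kap k|.
have S0 : 0 <= S by exact: sumr_ge0.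
(* The second bound makes the total bump error 8 S d^4 L at most d^3 / 3, a quarter of the mass [m];
   S + 1 in place of S keeps the denominator positive. *)
pose d := Num.min ((b - a) / 4) (24 * (S + 1) * L)^-1.
have SL : 0 < 24 * (S + 1) * L by apply: mulr_gt0 => //; lra.
have d0 : 0 < d by rewrite lt_min invr_gt0 SL andbT divr_gt0// subr_gt0.
have d1 : d <= (b - a) / 4 by rewrite ge_min lexx.
have d2 : d * (24 * (S + 1) * L) <= 1.
  by rewrite -ler_pdivlMr// div1r ge_min lexx orbT.
(* [minn] keeps the bumps inside [[a, b]] also for the indices [k > n]. *)
pose om (k : nat) := al + s * (minn k n)%:R / n%:R.
have om_itv k : al <= om k <= al + s.
  rewrite /om; apply/andP; split; first by rewrite lerDl divr_ge0// mulr_ge0// ltW.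
  rewrite lerD2l ler_pdivrMr//; apply: ler_wpM2l; first exact: ltW.
  by rewrite ler_nat geq_minr.
have oma k : a <= om k - d.
  rewrite lerBrDr; have /andP[+ _] := om_itv k; apply: le_trans.
  by rewrite lerD2l.
have omb k : om k + d <= b.
  have /andP[_ h] := om_itv k; apply: (le_trans (lerD h d1)).
  by rewrite le_eqVlt; apply/orP; left; apply/eqP; rewrite /al /s; field.
pose bp (k : nat) (x : R) : R[i] := (parabola d (x - om k))%:C.
have cbp k : ccontinuous (bp k) by exact: ccontinuous_parabola.
have [K HK] := choice (fun k => ler_cabs_band_parabola_sqr ab d0 (oma k) (omb k)).
pose phi0 (x : R) := \sum_(k < n.+1) (kap k)%:C * bp k x.
have ckb k : ccontinuous (fun x => (kap k)%:C * bp k x).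
  by apply: ccontinuousM => //; exact: ccontinuous_cst.
have cphi0 : ccontinuous phi0 by exact: (@ccontinuous_sum _ n.+1 (fun k x => (kap k)%:C * bp k x)).
have band0 z : band a b phi0 z = \sum_(k < n.+1) (kap k)%:C * band a b (bp k) z.
  rewrite (@band_sum _ a b n.+1 (fun k x => (kap k)%:C * bp k x))//.
  by apply: eq_bigr => k _; rewrite bandZ.
pose m := 4 / 3 * d ^+ 3.
have m0 : 0 < m by rewrite /m mulr_gt0 ?exprn_gt0//; lra.
(* The unnormalized real part will be at least m / 2 on [-L, L]; [q] rescales this to 1. *)
pose q := 2 / m; have q0 : 0 < q by rewrite divr_gt0.
pose KK := \sum_(k < n.+1) `|kap k| * `|K k|.
have KK0 : 0 <= KK by apply: sumr_ge0 => k _; exact: mulr_ge0.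
have sd0 : 0 <= q * (S * d ^+ 2).
  by apply: mulr_ge0; [exact: ltW|apply: mulr_ge0 => //; exact: sqr_ge0].
have qK0 : 0 <= q * KK by apply: mulr_ge0 => //; exact: ltW.
exists (fun x => q%:C * phi0 x), (1 + q * (S * d ^+ 2) + q * KK); split.
- by apply: ccontinuousM => //; exact: ccontinuous_cst.
- lra.
- move=> x; rewrite cabsM cabsR (gtr0_norm q0).
  suff : cabs (phi0 x) <= S * d ^+ 2.
    by move=> /(ler_wpM2l (ltW q0)); lra.
  apply: (le_trans (ler_cabs_sum _ _ _)); rewrite mulr_suml; apply: ler_sum => k _.
  rewrite cabsM !cabsR ler_wpM2l// (ger0_norm (parabola_ge0 _ _)); exact: parabola_le.
- move=> t; rewrite bandZ// cabsM cabsR (gtr0_norm q0).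
  have t0 : 0 < 1 + t ^+ 2 by have := sqr_ge0 t; lra.
  rewrite ler_pdivlMr//.
  suff : cabs (band a b phi0 t%:C) * (1 + t ^+ 2) <= KK.
    by move=> /(ler_wpM2l (ltW q0)); lra.
  rewrite -ler_pdivlMr// band0; apply: (le_trans (ler_cabs_sum _ _ _)).
  rewrite mulr_suml; apply: ler_sum => k _.
  rewrite cabsM cabsR -mulrA ler_wpM2l//; apply: (le_trans (HK _ _)).
  by rewrite ler_wpM2r ?invr_ge0 ?(ltW t0)// ler_norm.
move=> t tL; rewrite bandZ// cReM /= mul0r subr0.
suff : m / 2 <= Re (band a b phi0 t%:C).
  move=> H; apply: le_trans (ler_wpM2l (ltW q0) H).
  by rewrite /q mulrA mulfVK ?gt_eqF// divff.
pose P := \sum_(k < n.+1) (kap k)%:C * cexp ('i * (om k * t)%:C).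
have Bs : - (B * s) = al by rewrite /B -mulrA mulVf ?gt_eqF// mulr1 opprK.
have HP : cabs (P - 1) <= 4^-1.
  have := Hn _ tL; congr (cabs (_ - _) <= _); apply: eq_bigr => k _.
  by rewrite Bs /om (minn_idPl (leq_ord k)).
have HE : cabs (band a b phi0 t%:C - m%:C * P) <= S * (8 * d ^+ 4 * L).
  rewrite band0 mulr_sumr -sumrB.
  apply: (le_trans (ler_cabs_sum _ _ _)); rewrite mulr_suml; apply: ler_sum => k _.
  rewrite mulrCA -mulrBr cabsM cabsR ler_wpM2l//.
  apply: (le_trans (band_parabola_approx t d0 (oma k) (omb k))).
  by rewrite ler_wpM2l// mulr_ge0// exprn_ge0// ltW.
have HS : S * (8 * d ^+ 4 * L) <= m / 4.
  have -> : S * (8 * d ^+ 4 * L) = (d ^+ 3 / 3) * (d * (24 * S * L)) by field.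
  rewrite /m (_ : 4 / 3 * d ^+ 3 / 4 = d ^+ 3 / 3 * 1); last by field.
  apply: ler_wpM2l; first by rewrite divr_ge0// exprn_ge0// ltW.
  apply: le_trans d2; apply: ler_wpM2l; first exact: ltW.
  by apply: ler_wpM2r; [exact: ltW|lra].
(* One quarter of [m] is lost to the width of the bumps and one quarter to the superoscillating sum
   [P]. *)
have : cabs (band a b phi0 t%:C - m%:C) <= m / 2.
  have -> : band a b phi0 t%:C - m%:C = (band a b phi0 t%:C - m%:C * P) + m%:C * (P - 1) by ring.
  apply: (le_trans (ler_cabsD _ _)); rewrite cabsM cabsR (gtr0_norm m0).
  move: (ler_wpM2l (ltW m0) HP); lra.
move=> /(le_trans (ler_Re_cabs _)); rewrite cReD cReN /= ler_norml => /andP[]; lra.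
Qed.

End Block.

(** * Summation of the blocks *)

Section CauchyDensity.
Variable R : realType.
Notation mu := (@lebesgue_measure R).

(** The value is independent of [c], so the L^1 bound on the sum is insensitive to how far the
    blocks are moved. *)
Lemma integral_shifted_oneDsqr (c : R) :
  (\int[mu]_t ((1 + (t - c) ^+ 2)^-1)%:E = pi%:E)%E.
Proof.
pose G (x : R) := (oneDsqr x)^-1; pose F (x : R) := x - c.
have dF (x : R) : is_derive x 1 F 1.
  by rewrite -[X in is_derive _ _ _ X]subr0; apply: is_deriveB.
have F1 : derive1 F = cst 1.
  by apply/funext => x; rewrite derive1E; exact: derive_val.
have cG : continuous G by exact: continuous_oneDsqrV.
have G0 x : 0 <= G x by rewrite invr_ge0 addr_ge0// sqr_ge0.
transitivity (\int[mu]_x (((G \o F) * (derive1 F)) x)%:E)%E.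
  apply: eq_integral => x _; rewrite F1 /= /GRing.mul /=.
  by rewrite mulr1.
rewrite -increasing_ge0_integration_by_substitutionT//.
- rewrite ge0_symfun_integralT//; last by move=> x; rewrite /G /= /oneDsqr sqrrN.
  rewrite (_ : [set x | 0 <= x] = `[0, +oo[%classic); last first.
    by apply/seteqP; split => x /=; rewrite in_itv /= andbT.
  rewrite integral0y_oneDsqr -EFinM; congr EFin; by field.
- by move=> x y xy; rewrite /F /= ltrD2r.
- by rewrite F1; exact: cst_continuous.
- by rewrite F1; exact: is_cvg_cst.
- by rewrite F1; exact: is_cvg_cst.
- exact: (@cvg_addrr_Ny R (- c)).
- exact: (@cvg_addrr R (- c)).
Qed.

End CauchyDensity.

(** * Uniform limits of series dominated by a geometric one *)

Section GeometricSeries.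
Variable R : realType.
(** With ratio 1/16 the later blocks cost at most 1/15 and the earlier ones at most 1/60 of the
    current weight, well below one half. *)
Let q : R := 16^-1.
Implicit Types (x : R).

Lemma sum_geometric16 n : \sum_(k < n) q ^+ k.+1 = (1 - q ^+ n) / 15.
Proof.
elim: n => [|n IH]; first by rewrite big_ord0 expr0 subrr mul0r.
by rewrite big_ord_recr /= IH exprS /q; field.
Qed.

Lemma sum_geometric16_le n : \sum_(k < n) q ^+ k.+1 <= 15^-1.
Proof.
rewrite sum_geometric16; have : 0 <= q ^+ n by rewrite exprn_ge0// /q invr_ge0.
lra.
Qed.

Let q_ge0 n : 0 <= q ^+ n. Proof. by rewrite exprn_ge0// /q invr_ge0. Qed.

Lemma cvg_exp16 : (fun n => q ^+ n) @ \oo --> (0 : R).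
Proof. by apply: cvg_expr; rewrite /q ger0_norm ?invr_ge0//; lra. Qed.

Lemma geometric16_tail (g : nat -> R) N M : (N <= M)%N ->
  (forall k, `|g k| <= q ^+ k.+1) ->
  `|\sum_(k < M) g k - \sum_(k < N) g k| <= (q ^+ N - q ^+ M) / 15.
Proof.
move=> NM gq; elim: M NM => [|M IH].
  by rewrite leqn0 => /eqP ->; rewrite !subrr normr0 mul0r.
rewrite leq_eqVlt => /predU1P[->|]; first by rewrite !subrr normr0 mul0r.
rewrite ltnS => /IH {}IH; rewrite big_ord_recr /= addrAC.
apply: (le_trans (ler_normD _ _)).
apply: (le_trans (lerD IH (gq M))); rewrite exprS /q; lra.
Qed.

Lemma geometric16_limit (g : nat -> R) : (forall k, `|g k| <= q ^+ k.+1) ->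
  exists l, forall N, `|l - \sum_(k < N) g k| <= q ^+ N / 15.
Proof.
move=> gq.
have /cvg_ex[l] : cvgn (series g).
  apply: normed_cvg; apply: (@series_le_cvg _ _ (geometric q q)) => //.
  - by move=> n /=.
  - by move=> n /=; apply: mulr_ge0 => //; rewrite /q invr_ge0.
  - by move=> n; rewrite /geometric /= -exprS.
  - by apply: is_cvg_geometric_series; rewrite /q ger0_norm ?invr_ge0//; lra.
rewrite (_ : series g = (fun n => \sum_(k < n) g k)) => [gl|]; last first.
  by apply/funext => n; rewrite /series /= big_mkord.
exists l => N; apply/ler_addgt0Pr => e e0.
have /cvgrPdist_lt/(_ _ e0)[M _ HM] := gl.
(* A partial sum beyond both indices is close to the limit and within the tail bound of the N-th
   one. *)
pose K := maxn N M.
have h1 : `|l - \sum_(k < K) g k| < e by apply: HM; rewrite /= leq_maxr.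
have h2 := geometric16_tail (leq_maxl N M : (N <= K)%N) gq.
rewrite (_ : l - _ = (l - \sum_(k < K) g k) + (\sum_(k < K) g k - \sum_(k < N) g k)); last by ring.
apply: (le_trans (ler_normD _ _)); have := q_ge0 K; lra.
Qed.

Lemma geometric16_real_series (u : nat -> R -> R) : (forall k, continuous (u k)) ->
  (forall k x, `|u k x| <= q ^+ k.+1) ->
  exists2 f, continuous f & forall N x, `|f x - \sum_(k < N) u k x| <= q ^+ N / 15.
Proof.
move=> cu uq; have [f Hf] := choice (fun x => geometric16_limit (fun k => uq k x)).
exists f => // x.
apply/cvgrPdist_le => e e0.
have /cvgrPdist_lt/(_ _ e0)[N _ HN] := cvg_exp16.
have qN : q ^+ N < e by have := HN N (leqnn _); rewrite sub0r normrN ger0_norm.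
have cS : continuous (fun y => \sum_(k < N) u k y).
  elim: N {HN qN} => [|N IH] y.
    rewrite (_ : (fun _ => _) = cst 0); first exact: cvg_cst.
    by apply/funext => z; rewrite big_ord0.
  rewrite (_ : (fun _ => _) = (fun z => \sum_(k < N) u k z + u N z)); last first.
    by apply/funext => z; rewrite big_ord_recr.
  by apply: cvgD; [exact: IH|exact: cu].
have e2 : 0 < e / 2 by lra.
have /cvgrPdist_le/(_ _ e2) := cS x.
apply: filterS => y Hy.
rewrite (_ : f x - f y = (f x - \sum_(k < N) u k x) - (f y - \sum_(k < N) u k y)
  + (\sum_(k < N) u k x - \sum_(k < N) u k y)); last by ring.
apply: (le_trans (ler_normD _ _)).
apply: (le_trans (lerD (ler_normB _ _) (lexx _))).
have := Hf x N; have := Hf y N; have := q_ge0 N; lra.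
Qed.

Lemma geometric16_series (u : nat -> R -> R[i]) : (forall k, ccontinuous (u k)) ->
  (forall k x, cabs (u k x) <= q ^+ k.+1) ->
  exists2 f, ccontinuous f & forall N x, cabs (f x - \sum_(k < N) u k x) <= q ^+ N.
Proof.
move=> cu uq.
have [f cf Hf] := @geometric16_real_series (fun k x => Re (u k x))
  (fun k => (cu k).1) (fun k x => le_trans (ler_Re_cabs _) (uq k x)).
have [g cg Hg] := @geometric16_real_series (fun k x => Im (u k x))
  (fun k => (cu k).2) (fun k x => le_trans (ler_Im_cabs _) (uq k x)).
exists (fun x => f x +i* g x) => // N x.
have ReS n : Re (\sum_(k < n) u k x) = \sum_(k < n) Re (u k x).
  by elim: n => [|n IH]; rewrite ?big_ord0// !big_ord_recr /= cReD IH.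
have ImS n : Im (\sum_(k < n) u k x) = \sum_(k < n) Im (u k x).
  by elim: n => [|n IH]; rewrite ?big_ord0// !big_ord_recr /= cImD IH.
apply: (le_trans (ler_cabs_ReIm _)); rewrite cReD cImD cReN cImN ReS ImS /=.
by have := Hf N x; have := Hg N x; have := q_ge0 N; lra.
Qed.

End GeometricSeries.

(** * The weighted sum of shifted blocks *)

Section GapDensity.
Variables (R : realType) (a b : R).
Hypothesis ab : a < b.
Notation mu := (@lebesgue_measure R).
Let q : R := 16^-1.

Let q0 : 0 < q. Proof. by rewrite /q invr_gt0. Qed.

Let qX n : 0 < q ^+ n. Proof. exact: exprn_gt0. Qed.

Lemma exp16_lt (e : R) : 0 < e -> exists N, forall n, (N <= n)%N -> q ^+ n < e.
Proof.
move=> e0; have /cvgrPdist_lt/(_ _ e0)[N _ HN] := @cvg_exp16 R.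
exists N => n Nn; have := HN n Nn.
by rewrite sub0r normrN gtr0_norm// qX.
Qed.

Variables (P : nat -> R -> R[i]) (C : nat -> R).
Hypotheses (cP : forall k, ccontinuous (P k)) (C1 : forall k, 1 <= C k).
Hypothesis PC : forall k x, cabs (P k x) <= C k.
Hypothesis bandP : forall k t, cabs (band a b (P k) t%:C) <= C k / (1 + t ^+ 2).
Hypothesis Ppos : forall (k : nat) (t : R), `|t| <= k.+1%:R -> 1 <= Re (band a b (P k) t%:C).

(* [eps k.+1 * C k.+1 = eps k / 16], so the terms after the k-th one add up to at
   most [eps k / 15]. *)
Let eps k := \prod_(j < k.+1) (16 * C j)^-1.

Let C0 k : 0 < C k. Proof. exact: lt_le_trans (C1 k). Qed.

Let eps_gt0 k : 0 < eps k.
Proof. by apply: prodr_gt0 => j _; rewrite invr_gt0 mulr_gt0. Qed.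

Let epsS k : eps k.+1 * C k.+1 = eps k * q.
Proof.
rewrite /eps big_ord_recr /= -mulrA; congr (_ * _).
by rewrite invfM mulfVK// gt_eqF.
Qed.

Let eps_le k : eps k * C k <= q ^+ k.+1.
Proof.
elim: k => [|k IH].
  by rewrite /eps big_ord_recr big_ord0 /= mul1r invfM mulfVK ?gt_eqF.
rewrite epsS exprSr ler_pM2r//; apply: le_trans IH.
by rewrite ler_pMr.
Qed.

Let eps_after k i : eps (i.+1 + k) * C (i.+1 + k) <= eps k * q ^+ i.+1.
Proof.
elim: i => [|i IH]; first by rewrite add1n epsS expr1.
rewrite addSn epsS exprSr mulrA ler_pM2r//; apply: le_trans IH.
by rewrite ler_pMr.
Qed.

(* On [|t - c k| <= k.+1] and for [j < k] the spacing gives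
   [1 + (t - c j)^2 >= 4 / eps k]. *)
Let c k := \sum_(j < k.+1) (j.+1%:R + 2 / eps j).

Let cS k : c k.+1 = c k + (k.+2%:R + 2 / eps k.+1).
Proof. by rewrite /c big_ord_recr. Qed.

Let c_le j i : c j <= c (i + j).
Proof.
elim: i => [|i IH]; first by rewrite add0n.
rewrite addSn cS; apply: (le_trans IH).
by rewrite lerDl addr_ge0// divr_ge0// ltW.
Qed.

Let c_sep j i : (i.+1 + j).+1%:R + 2 / eps (i.+1 + j) <= c (i.+1 + j) - c j.
Proof. by rewrite addSn cS lerBrDr [leRHS]addrC lerD2l c_le. Qed.

Let u k x := (eps k)%:C * (P k x * cexp ('i * x%:C * (- c k)%:C)).

Let cu k : ccontinuous (u k).
Proof.
apply: ccontinuousM; first exact: ccontinuous_cst.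
exact: ccontinuous_band_kernel.
Qed.

Let u_le k x : cabs (u k x) <= q ^+ k.+1.
Proof.
rewrite /u -mulrA -rmorphM !cabsM cabs_cexp_imag mulr1 cabsR gtr0_norm//.
apply: le_trans (eps_le k); by rewrite ler_pM2l.
Qed.

Let T k t := band a b (u k) t%:C.

Let TE k t : T k t = (eps k)%:C * band a b (P k) (t - c k)%:C.
Proof.
rewrite /T /u bandZ; last exact: ccontinuous_band_kernel.
by rewrite band_shift.
Qed.

Let cabs_T k t : cabs (T k t) <= eps k * C k * (1 + (t - c k) ^+ 2)^-1.
Proof.
by rewrite TE cabsM cabsR gtr0_norm// -mulrA ler_pM2l.
Qed.

Let den0 (x : R) : 0 < 1 + x ^+ 2.
Proof. by rewrite ltr_pwDl// sqr_ge0. Qed.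

Let T_before k i t : `|t - c (i.+1 + k)| <= (i.+1 + k).+1%:R ->
  cabs (T k t) <= q ^+ k.+1 * (eps (i.+1 + k) / 4).
Proof.
move=> tc; apply: (le_trans (cabs_T k t)).
have e0 := eps_gt0 (i.+1 + k).
apply: ler_pM; [by rewrite ltW// mulr_gt0|by rewrite invr_ge0 ltW|exact: eps_le|].
(* The integer summand in the spacing pays for the half-length of the interval around the later
   centre; the rest is left as distance. *)
have h : 2 / eps (i.+1 + k) <= t - c k.
  have := c_sep k i; move: tc; rewrite ler_norml => /andP[].
  lra.
have d0 : 0 < 2 / eps (i.+1 + k) by rewrite divr_gt0.
(* From 1 + x^2 >= 2 x; a distance proportional to 1 / eps is therefore enough. *)
have h2 : 4 / eps (i.+1 + k) <= 1 + (t - c k) ^+ 2.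
  have : 0 <= (t - c k - 1) ^+ 2 by exact: sqr_ge0.
  rewrite sqrrB; lra.
rewrite -[leRHS]invf_div lef_pV2 ?posrE//.
by rewrite divr_gt0.
Qed.

Let T_after k i t : cabs (T (i.+1 + k) t) <= eps k * q ^+ i.+1.
Proof.
apply: (le_trans (cabs_T _ t)); apply: le_trans (eps_after k i).
rewrite ler_piMr//; first by rewrite ltW// mulr_gt0.
by rewrite invf_le1// lerDl sqr_ge0.
Qed.

(** The k-th term has real part at least [eps k], and both groups of other terms are small multiples
    of [eps k]. The bound is uniform in [n], so it survives the passage to the limit. *)
Let T_partial k n t : `|t - c k| <= k.+1%:R ->
  eps k / 2 <= Re (\sum_(j < n + k.+1) T j t).
Proof.
move=> tc; have e0 := eps_gt0 k.
have hb : cabs (\sum_(j < k) T j t) <= eps k / 60.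
  apply: (le_trans (ler_cabs_sum _ _ _)).
  apply: (@le_trans _ _ (\sum_(j < k) q ^+ j.+1 * (eps k / 4))).
    apply: ler_sum => j _.
    (* [T_before] is indexed by the gap between the two blocks, so [k] is rewritten as gap plus
       [j]. *)
    have kE : k = ((k - j.+1).+1 + j)%N by rewrite addSnnS subnK.
    by rewrite [in eps k]kE; apply: T_before; rewrite -kE.
  rewrite -mulr_suml; have := @sum_geometric16_le R k; rewrite -/q => h.
  have : (\sum_(j < k) q ^+ j.+1) * (eps k / 4) <= 15^-1 * (eps k / 4).
    by rewrite ler_pM2r// divr_gt0.
  lra.
(* Keeping the exact sum of the later losses makes the bound inductive in [n]; 1/60 is 1/15 times
   the 1/4 of [T_before]. *)
suff : eps k - eps k / 60 - eps k * \sum_(i < n) q ^+ i.+1 <=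
    Re (\sum_(j < n + k.+1) T j t).
  have := @sum_geometric16_le R n; rewrite -/q => h.
  have : eps k * (\sum_(i < n) q ^+ i.+1) <= eps k * 15^-1 by rewrite ler_pM2l.
  lra.
elim: n => [|n IH].
  rewrite add0n big_ord0 mulr0 subr0 big_ord_recr /= cReD.
  have : eps k <= Re (T k t).
    by rewrite TE cReM /= mul0r subr0 ler_pMr// Ppos.
  have := le_trans (ler_Re_cabs _) hb; rewrite ler_norml => /andP[].
  lra.
rewrite addSn !big_ord_recr /= cReD.
have := le_trans (ler_Re_cabs _) (T_after k n t); rewrite addSnnS ler_norml => /andP[].
lra.
Qed.

Let w k t := q ^+ k.+1 * (1 + (t - c k) ^+ 2)^-1.

Let w_ge0 k t : 0 <= w k t.
Proof. by rewrite /w mulr_ge0 ?invr_ge0 ?ltW. Qed.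

Let cabs_T_w k t : cabs (T k t) <= w k t.
Proof.
apply: (le_trans (cabs_T k t)); apply: ler_wpM2r; last exact: eps_le.
by rewrite invr_ge0 ltW.
Qed.

Let continuous_w k : continuous (w k).
Proof.
move=> t; apply: cvgM; first exact: cvg_cst.
apply: cvgV; first by rewrite gt_eqF.
apply: cvgD; first exact: cvg_cst.
by apply: cvgM; (apply: cvgB; [exact: cvg_id|exact: cvg_cst]).
Qed.

Let measurable_w k : measurable_fun setT (fun t => (w k t)%:E : \bar R).
Proof.
by apply/measurable_EFinP; apply: continuous_measurable_fun; exact: continuous_w.
Qed.

(** An integrable majorant of all partial sums. As an extended real it exists at every point without
    a convergence proof, and termwise integration bounds its integral by pi / 15. *)
Let m t := (\sum_(k <oo) (w k t)%:E)%E.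

Let integral_w k : (\int[mu]_t (w k t)%:E = (q ^+ k.+1 * pi)%:E)%E.
Proof.
rewrite EFinM -(integral_shifted_oneDsqr (c k)) -ge0_integralZl_EFin//.
- by move=> x _; rewrite lee_fin invr_ge0 ltW.
- apply/measurable_EFinP; apply: continuous_measurable_fun => t.
  apply: cvgV; first by rewrite gt_eqF.
  apply: cvgD; first exact: cvg_cst.
  by apply: cvgM; (apply: cvgB; [exact: cvg_id|exact: cvg_cst]).
- exact: ltW.
Qed.

Let integrable_m : mu.-integrable setT m.
Proof.
apply/integrableP; split.
  apply: ge0_emeasurable_sum => [k x _ _|k _]; last exact: measurable_w.
  by rewrite lee_fin.
have -> : (\int[mu]_x `|m x|)%E = (\int[mu]_x m x)%E.
  apply: eq_integral.
  by move=> x _; rewrite gee0_abs//; apply: nneseries_ge0 => k _ _; rewrite lee_fin.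
rewrite /m (@integral_nneseries _ _ _ mu setT measurableT (fun k t => (w k t)%:E))//; last first.
  by move=> k x _; rewrite lee_fin.
apply: (@le_lt_trans _ _ (15^-1 * pi)%:E); last exact: ltry.
apply: lime_le.
  by apply: is_cvg_nneseries => k _ _; rewrite integral_w lee_fin mulr_ge0 ?ltW ?pi_gt0.
apply: nearW => n; under eq_bigr do rewrite integral_w.
rewrite sumEFin lee_fin -mulr_suml big_mkord ler_pM2r ?pi_gt0//.
exact: sum_geometric16_le.
Qed.

(** The limit is taken among densities on [a, b], not among entire functions, so band-limitation
    passes to it at once. *)
Lemma gap_density_exists : exists2 phi : R -> R[i],
  ccontinuous phi /\ cintegrable setT (fun t => band a b phi t%:C) &
  exists c : nat -> R,
    forall (k : nat) t, `|t - c k| <= k.+1%:R -> 0 < Re (band a b phi t%:C).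
Proof.
have [phi cphi Hphi] := geometric16_series cu u_le.
have ba : 0 < b - a by rewrite subr_gt0.
(* The densities converge uniformly on a bounded interval, so their transforms converge uniformly on
   the line; this serves both integrability and positivity. *)
have approx N t : cabs (band a b phi t%:C - \sum_(k < N) T k t) <= 2 * (q ^+ N * (b - a)).
  have cSum : ccontinuous (fun x => \sum_(k < N) u k x) by exact: ccontinuous_sum.
  have cS1 : ccontinuous (fun x => -1 * \sum_(k < N) u k x).
    by apply: ccontinuousM => //; exact: ccontinuous_cst.
  rewrite /T -band_sum// -mulN1r -bandZ// -bandD//.
  apply: ler_cabs_band_real => //; first exact: ccontinuousD.
  by move=> x _; rewrite mulN1r; exact: Hphi.
have small e : 0 < e -> exists N, forall n, (N <= n)%N -> 2 * (q ^+ n * (b - a)) < e.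
  move=> e0; have e1 : 0 < e / (2 * (b - a)) by rewrite divr_gt0// mulr_gt0.
  have [N HN] := exp16_lt e1; exists N => n /HN.
  by rewrite ltr_pdivlMr ?mulr_gt0// mulrCA.
exists phi; first split => //.
  have cB := ccontinuous_band ab cphi.
  (* For each [e], a partial sum within [e] of the transform is dominated by a partial sum of
     [m]. *)
  have Bm t : ((cabs (band a b phi t%:C))%:E <= m t)%E.
    apply/lee_addgt0Pr => e e0; have [N HN] := small _ e0.
    have h : cabs (band a b phi t%:C) <= \sum_(0 <= k < N) w k t + e.
      rewrite big_mkord.
      have -> : band a b phi t%:C =
        \sum_(k < N) T k t + (band a b phi t%:C - \sum_(k < N) T k t) by ring.
      apply: (le_trans (ler_cabsD _ _)); apply: lerD; last first.
        by apply: (le_trans (approx N t)); apply: ltW; exact: HN.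
      by apply: (le_trans (ler_cabs_sum _ _ _)); apply: ler_sum => k _.
    apply: (@le_trans _ _ (\sum_(0 <= k < N) w k t + e)%:E); first by rewrite lee_fin.
    rewrite EFinD leeD2r// -sumEFin.
    by apply: nneseries_lim_ge => k _ _; rewrite lee_fin.
  have key (h : R -> R) : continuous h ->
      (forall t, `|h t| <= cabs (band a b phi t%:C)) -> mu.-integrable setT (EFin \o h).
    move=> ch hB; apply: le_integrable integrable_m => //.
      by apply/measurable_EFinP; exact: continuous_measurable_fun.
    move=> t _; apply: le_trans (lee_abs _); apply: le_trans (Bm t).
    by rewrite lee_fin.
  split; apply: key; [exact: cB.1|by move=> t; exact: ler_Re_cabs|
    exact: cB.2|by move=> t; exact: ler_Im_cabs].
(* The partial sum with N + k + 1 terms contains the k-th block and has real part at least eps k /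
   2; the remainder takes away less than eps k / 4. *)
exists c => k t tc; have e4 : 0 < eps k / 4 by rewrite divr_gt0.
have [N HN] := small _ e4.
have h1 := T_partial N tc.
have h2 := le_trans (approx (N + k.+1)%N t) (ltW (HN _ (leq_addr _ _))).
have := le_trans (ler_Re_cabs _) h2; rewrite cReD cReN ler_norml => /andP[].
have := eps_gt0 k; lra.
Qed.

End GapDensity.

Theorem mainTheorem2 (R : realType) (a b : R) (ha : 0 < a) (hab : a < b) :
  exists f : R[i] -> R[i],
    [/\ real_entire f,
        exponential_type b f,
        (exists M : R, forall x : R, cabs (f x%:C) <= M),
        cintegrable setT (fun x : R => f x%:C) &
        spectral_gap a (fun x : R => f x%:C)] /\
    exists y x : nat -> R,
      [/\ forall k : nat, y k < x k,
          (x k - y k) @[k --> \oo] --> +oo &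
          forall k : nat, forall t : R, t \in `[y k, x k] -> f t%:C != 0].
Proof.
(* The k-th block is positive up to L = k + 1, which becomes the half-length of the k-th interval
   around [c k]. *)
have [P HP] := choice (fun k : nat => positive_block hab (ltr0Sn R k)).
have [C HC] := choice HP.
have [phi [cphi iphi] [c Hc]] := @gap_density_exists R a b hab P C
  (fun k => let: And5 h _ _ _ _ := HC k in h)
  (fun k => let: And5 _ h _ _ _ := HC k in h)
  (fun k => let: And5 _ _ h _ _ := HC k in h)
  (fun k => let: And5 _ _ _ h _ := HC k in h)
  (fun k => let: And5 _ _ _ _ h := HC k in h).
exists (real_band a b phi); split.
  split.
  - exact: real_entire_real_band.
  - exact: exponential_type_real_band.
  - exact: bounded_real_band.
  - exact: cintegrable_real_band.
  - exact: spectral_gap_real_band.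
exists (fun k => c k - k.+1%:R), (fun k => c k + k.+1%:R); split.
- by move=> k; rewrite ltrD2l gtrN.
- apply/cvgryPge => A; near=> k.
  apply: (@le_trans _ _ k%:R); first by near: k; exact: nbhs_infty_ger.
  have -> : c k + k.+1%:R - (c k - k.+1%:R) = (k.+1 + k.+1)%:R by rewrite natrD; ring.
  by rewrite ler_nat (leq_trans (leqnSn k))// leq_addr.
- move=> k t; rewrite in_itv /= => /andP[t1 t2].
  have tc : `|t - c k| <= k.+1%:R by rewrite ler_norml; apply/andP; split; lra.
  have r0 := Hc k t tc; rewrite real_bandE; apply/eqP => /(congr1 (@complex.Re R)) /=.
  by apply/eqP; rewrite mulf_neq0// gt_eqF.
Unshelve. all: by end_near. Qed.
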